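(* There is a deterministic algorithm that, given a directed graph $G$ (with a set $V^\infty(G)$ of undeletable vertices), a set $T\subseteq V(G)$ and an integer $k$, produces in time $O^*(2^{O(k^2)})$ subsets $Z_1,\dots,Z_t$ of $V(G)\setminus T$ with $t=2^{O(k^2)}\log|V(G)|$ such that the following holds. Let $W$ be a thin set with $|W|\le k$, and let $Y$ be a set of vertices such that for every $v\in Y$ there is an important $v-T$ separator $W'\subseteq W$. For every such pair $(W,Y)$ there is at least one $i\in[t]$ with $W\cap Z_i=\emptyset$ and $Y\subseteq Z_i$.
   Context: $O^*(\cdot)$ hides polynomial factors in the input size. $G$ has a (possibly empty) set $V^\infty(G)$ of undeletable vertices. For disjoint nonempty $A,B\subseteq V(G)$, a set $W\subseteq V(G)\setminus(A\cup B\cup V^\infty(G))$ is an $A-B$ separator if $G\setminus W$ has no path from $A$ to $B$; it is minimal if no proper subset is an $A-B$ separator. We write $v-T$ for $\{v\}-T$. For a digraph $H$ and $A\subseteq V(H)$, $R^+_H(A)$ is the set of vertices reachable from $A$ in $H$. A minimal $A-B$ separator $W$ is an important $A-B$ separator if there is no $A-B$ separator $W'$ with $|W'|\le|W|$ and $R^+_{G\setminus W}(A)\subsetneq R^+_{G\setminus W'}(A)$. The reverse shadow of a set $W\subseteq V(G)\setminus V^\infty(G)$ (with respect to $T$) is the set of vertices $v$ such that $W$ is a $v-T$ separator. A set $W$ is thin if no $v\in W$ belongs to the reverse shadow of $W\setminus\{v\}$ with respect to $T$.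
   Formalization: W is required to avoid T and the undeletable vertices (otherwise W is vacuously thin and the claim fails, e.g. path v→w→t, T={t}, W={t,v,w}, Y={v}), and log|V(G)| is read as 1 when |V(G)| ≤ 1, where it would force t = 0. *)

(* Defs.v *)
From mathcomp Require Import all_boot.

Set Implicit Arguments.
Unset Strict Implicit.
Unset Printing Implicit Defensive.

Record digraph := Digraph {
  nb_vertices : nat;
  edge : rel 'I_nb_vertices;
  undeletable : {set 'I_nb_vertices}
}.

Notation vertex G := 'I_(nb_vertices G).

Section Separators.
Variable G : digraph.
Implicit Types A B T W : {set vertex G}.

(* The edges of G \ W.  Vertices of W remain in the carrier, as isolated
   points; [reach] discards them. *)
Definition edge_minus W : rel (vertex G) :=
  [rel u v | [&& edge u v, u \notin W & v \notin W]].

Definition reach W A : {set vertex G} :=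
  [set v | [exists u in A, (u \notin W) && connect (edge_minus W) u v]].

Definition separator A B W : bool :=
  [&& A != set0, B != set0, [disjoint A & B],
      W \subset ~: (A :|: B :|: undeletable G) &
      [forall a in A, forall b in B, ~~ connect (edge_minus W) a b]].

Definition minimal_separator A B W : Prop :=
  separator A B W /\ forall W', W' \proper W -> ~~ separator A B W'.

Definition important_separator A B W : Prop :=
  minimal_separator A B W /\
  ~ exists W', [/\ separator A B W', #|W'| <= #|W|
                 & reach W A \proper reach W' A].

Definition reverse_shadow T W : {set vertex G} :=
  [set v | separator [set v] T W].

Definition thin T W : Prop :=
  forall v, v \in W -> v \notin reverse_shadow T (W :\ v).

End Separators.

(* The model of computation for algorithms:
   first-order recursive programs on numbers and pairs, call by value, where
   every evaluation step costs one unit.  Addition and truncated subtraction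
   are the only arithmetic, so after s steps numbers have at most s more bits
   than the input and the program constants; hence the model is polynomially
   equivalent to Turing machines. *)

Inductive data := VNat of nat | VPair of data & data.

(* [EVar i] is a de Bruijn index.  [ECall f e] runs the f-th function of the
   program on the value of e, in an environment holding only that value. *)
Inductive expr :=
  | EVar of nat
  | EConst of nat
  | EAdd of expr & expr
  | ESub of expr & expr
  | EMkPair of expr & expr
  | EFst of expr
  | ESnd of expr
  | EIsPair of expr
  | EIf of expr & expr & expr
  | ELet of expr & expr
  | ECall of nat & expr.

Definition program := seq expr.

Definition is_pair (v : data) : bool := if v is VPair _ _ then true else false.

(* [eval P env e v t]: in environment env, e evaluates to v in t steps. *)
Inductive eval (P : program) : seq data -> expr -> data -> nat -> Prop :=
  | EvVar env i : eval P env (EVar i) (nth (VNat 0) env i) 1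
  | EvConst env n : eval P env (EConst n) (VNat n) 1
  | EvAdd env e1 e2 a b t1 t2 :
      eval P env e1 (VNat a) t1 -> eval P env e2 (VNat b) t2 ->
      eval P env (EAdd e1 e2) (VNat (a + b)) (t1 + t2).+1
  | EvSub env e1 e2 a b t1 t2 :
      eval P env e1 (VNat a) t1 -> eval P env e2 (VNat b) t2 ->
      eval P env (ESub e1 e2) (VNat (a - b)) (t1 + t2).+1
  | EvMkPair env e1 e2 v w t1 t2 :
      eval P env e1 v t1 -> eval P env e2 w t2 ->
      eval P env (EMkPair e1 e2) (VPair v w) (t1 + t2).+1
  | EvFst env e v w t :
      eval P env e (VPair v w) t -> eval P env (EFst e) v t.+1
  | EvSnd env e v w t :
      eval P env e (VPair v w) t -> eval P env (ESnd e) w t.+1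
  | EvIsPair env e v t :
      eval P env e v t -> eval P env (EIsPair e) (VNat (is_pair v)) t.+1
  | EvIf env e e1 e2 n v t1 t2 :
      eval P env e (VNat n) t1 ->
      eval P env (if n == 0 then e2 else e1) v t2 ->
      eval P env (EIf e e1 e2) v (t1 + t2).+1
  | EvLet env e1 e2 v w t1 t2 :
      eval P env e1 v t1 -> eval P (v :: env) e2 w t2 ->
      eval P env (ELet e1 e2) w (t1 + t2).+1
  | EvCall env f e v w t1 t2 :
      eval P env e v t1 -> eval P [:: v] (nth (EConst 0) P f) w t2 ->
      eval P env (ECall f e) w (t1 + t2).+1.

(* The entry point of a program is its function number 0. *)
Definition runs (P : program) (input output : data) (time : nat) : Prop :=
  eval P [:: input] (nth (EConst 0) P 0) output time.

Lemma eval_det P env e v t v' t' :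
  eval P env e v t -> eval P env e v' t' -> v = v' /\ t = t'.
Proof.
move=> ev; elim: ev v' t' => {env e v t}.
- by move=> env i v' t' ev; inversion ev.
- by move=> env n v' t' ev; inversion ev.
- move=> env e1 e2 a b t1 t2 _ IH1 _ IH2 v' t' ev; inversion ev; subst.
  case: (IH1 _ _ ltac:(eassumption)) => -[->] ->.
  by case: (IH2 _ _ ltac:(eassumption)) => -[->] ->.
- move=> env e1 e2 a b t1 t2 _ IH1 _ IH2 v' t' ev; inversion ev; subst.
  case: (IH1 _ _ ltac:(eassumption)) => -[->] ->.
  by case: (IH2 _ _ ltac:(eassumption)) => -[->] ->.
- move=> env e1 e2 v w t1 t2 _ IH1 _ IH2 v' t' ev; inversion ev; subst.
  case: (IH1 _ _ ltac:(eassumption)) => -> ->.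
  by case: (IH2 _ _ ltac:(eassumption)) => -> ->.
- move=> env e v w t _ IH v' t' ev; inversion ev; subst.
  by case: (IH _ _ ltac:(eassumption)) => -[-> _] ->.
- move=> env e v w t _ IH v' t' ev; inversion ev; subst.
  by case: (IH _ _ ltac:(eassumption)) => -[_ ->] ->.
- move=> env e v t _ IH v' t' ev; inversion ev; subst.
  by case: (IH _ _ ltac:(eassumption)) => -> ->.
- move=> env e e1 e2 n v t1 t2 _ IH1 _ IH2 v' t' ev; inversion ev; subst.
  case: (IH1 _ _ ltac:(eassumption)) => -[En] ->; subst.
  by case: (IH2 _ _ ltac:(eassumption)) => -> ->.
- move=> env e1 e2 v w t1 t2 _ IH1 _ IH2 v' t' ev; inversion ev; subst.
  case: (IH1 _ _ ltac:(eassumption)) => Ev ->; subst.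
  by case: (IH2 _ _ ltac:(eassumption)) => -> ->.
move=> env f e v w t1 t2 _ IH1 _ IH2 v' t' ev; inversion ev; subst.
case: (IH1 _ _ ltac:(eassumption)) => Ev ->; subst.
by case: (IH2 _ _ ltac:(eassumption)) => -> ->.
Qed.

Definition enc_seq (s : seq data) : data := foldr VPair (VNat 0) s.

Definition enc_set n (A : {set 'I_n}) : data :=
  enc_seq [seq VNat (nat_of_ord i) | i <- enum A].

(* |V(G)|, the out-neighbour list of each vertex, the undeletable vertices,
   T, and k. *)
Definition enc_input (G : digraph) (T : {set vertex G}) (k : nat) : data :=
  VPair (VNat (nb_vertices G))
    (VPair (enc_seq [seq enc_set [set v | edge u v] | u <- enum (vertex G)])
       (VPair (enc_set (undeletable G)) (VPair (enc_set T) (VNat k)))).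

Definition enc_output n (Z : seq {set 'I_n}) : data :=
  enc_seq [seq enc_set A | A <- Z].

(* Numbers are measured in binary. *)
Fixpoint data_size (v : data) : nat :=
  match v with
  | VNat n => (trunc_log 2 n).+1
  | VPair a b => (data_size a + data_size b).+1
  end.

Definition bigO (f g : nat -> nat) : Prop :=
  exists c k0, forall k, k0 <= k -> f k <= c * g k.

(* The binary logarithm, rounded down, except that log 0 and log 1 are taken
   to be 1: with value 0 the bound would allow no set at all in a graph on at
   most one vertex. *)
Definition log2 (n : nat) : nat := maxn 1 (trunc_log 2 n).

(* Main.v *)
Require Import Defs.
From HB Require Import structures.
From mathcomp Require Import all_boot.
From mathcomp Require Import zify.

(** For a vertex v, branching on the furthest minimum v-T cut lists at most
    2^(2k+1) sets L(v): all of them are v-T separators, and every important v-T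
    separator of size at most k occurs, because with 2(|S| - |D|) minus the size
    of the minimum cut as measure, where D is the set of vertices of S already
    chosen, each branching step makes progress.  For a set P of vertices put
    Z(P) = { v notin T : some D in L(v) is contained in P }.
    If W is contained in P then Y is contained in Z(P).  If w is in W, thinness
    says that no D in L(w) is contained in W, so W and Z(P) are disjoint as soon
    as P misses one vertex of D \ W for each of the at most k 2^(2k+1) such
    pairs (w, D).

    To find such a P, colour the vertices by functions h into 2^(4k+3) colours
    and let P be the set of vertices whose colour lies in a k-tuple of colours;
    it suffices that some h of the family gives no vertex of W the colour of a
    vertex to be missed.  The family is built greedily: the weight of a pair of
    vertices doubles at each collision, and giving each vertex in turn its
    cheapest colour among q multiplies the total weight by at most 1 + 1/q, so
    that after O(2^(4k) log n) functions each pair collides too rarely for all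
    functions to be bad.

    The algorithm is a program for the machine of the statement whose functions
    compute the corresponding Rocq functions; a loop over a list of length at
    most m multiplies the cost by O(m). *)

Set Implicit Arguments.
Unset Strict Implicit.
Unset Printing Implicit Defensive.

(** * Backward search *)

Lemma count_ltn (T : eqType) (p q : pred T) s x :
  {in s, subpred p q} -> x \in s -> q x -> ~~ p x -> count p s < count q s.
Proof.
move=> sub xs qx px; rewrite -[ltnRHS]size_filter.
rewrite -(count_predC p [seq y <- s | q y]) !count_filter.
have -> : count (predI p q) s = count p s.
  by apply: eq_in_count => y ys /=; rewrite andb_idr //; apply: sub.
rewrite -[ltnLHS]addn0 ltn_add2l -has_count.
by apply/hasP; exists x; rewrite //= px.
Qed.

Lemma iter_fixpoint (T : Type) (f : T -> T) (phi : T -> nat) n x :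
  (forall y, f y = y \/ phi (f y) < phi y) -> phi x <= n ->
  f (iter n f x) = iter n f x.
Proof.
move=> dec; elim: n x => [|n IH] x le.
  by case: (dec x) => // /leq_trans/(_ le).
by rewrite iterSr; case: (dec x) => [fx|lt];
  [rewrite fx iter_fix | apply: IH; rewrite -ltnS; apply: leq_trans le].
Qed.

Section Assoc.
Variables (K : eqType) (V : Type).
Implicit Types B : seq (K * V).

Fixpoint assoc (x : K) B : option V :=
  if B is e :: B' then if e.1 == x then Some e.2 else assoc x B' else None.

Lemma isSome_assoc x B : isSome (assoc x B) = (x \in unzip1 B).
Proof. by elim: B => //= e B IH; rewrite inE eq_sym -IH; case: eqP. Qed.

End Assoc.

Lemma assoc_mem (K V : eqType) x (B : seq (K * V)) v :
  assoc x B = Some v -> (x, v) \in B.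
Proof.
elim: B => //= -[y w] B IH; rewrite inE; case: eqP => /= [-> [->]|_ /IH ->].
  by rewrite eqxx.
by rewrite orbT.
Qed.

Lemma assoc_uniq (K V : eqType) (B : seq (K * V)) e :
  uniq (unzip1 B) -> e \in B -> assoc e.1 B = Some e.2.
Proof.
elim: B => //= f B IH /andP[fB uB]; rewrite inE => /orP[/eqP ->|eB].
  by rewrite eqxx.
by rewrite ifN ?IH //; apply: contraNneq fB => ->; apply: map_f.
Qed.

Notation arcs V := (seq (V * V)).

(* A search table lists the vertices that reach a target, each with a path. *)
Notation table V := (seq (V * arcs V)).

Section BackwardSearch.
Variables (V : eqType) (Ts : seq V).
Implicit Types (a : V * V) (A s p : arcs V) (B : table V) (R Q : pred V).

Definition relax a B : table V :=
  if a.1 \in unzip1 B then B else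
  if assoc a.2 B is Some p then (a.1, a :: p) :: B else B.

Fixpoint round A B : table V :=
  if A is a :: A' then relax a (round A' B) else B.

Definition init_table : table V := [seq (t, [::]) | t <- Ts].

Definition bfs A : table V := iter (size A) (round A) init_table.

Definition unreached B : pred V := [pred x | x \notin unzip1 B].

Definition arc_closed A R : bool := all (fun a => R a.1 ==> R a.2) A.

Fixpoint walk (x : V) p : bool :=
  if p is a :: p' then (a.1 == x) && walk a.2 p' else x \in Ts.

Lemma walk_closed A Q x p :
  walk x p -> {subset p <= A} -> arc_closed A Q -> Q x -> has Q Ts.
Proof.
elim: p x => [|a p IH] x /=; first by move=> xT _ _ Qx; apply/hasP; exists x.
case/andP => /eqP <- wp sub cl Qa; apply: (IH a.2) => //.
  by move=> b bp; apply: sub; rewrite inE bp orbT.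
by have /implyP := allP cl _ (sub _ (mem_head _ _)); apply.
Qed.

Definition path_table A B :=
  forall e, e \in B ->
  [/\ walk e.1 e.2, {subset e.2 <= A}, uniq (unzip1 e.2)
    & {subset unzip1 e.2 <= unzip1 B}].

Lemma unzip1_relax B a :
  unzip1 (relax a B) =
  if (a.1 \notin unzip1 B) && (a.2 \in unzip1 B) then a.1 :: unzip1 B
  else unzip1 B.
Proof.
rewrite /relax -(isSome_assoc a.2).
by case: (a.1 \in unzip1 B) => //=; case: (assoc a.2 B).
Qed.

Lemma path_table_relax A B a :
  a \in A -> path_table A B -> path_table A (relax a B).
Proof.
move=> aA tab; rewrite /relax; have [//|a1B] := boolP (a.1 \in _).
case Ep: (assoc a.2 B) => [p|//]; have [wp sp up kp] := tab _ (assoc_mem Ep).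
move=> f; rewrite inE => /orP[/eqP ->|fB] /=.
  split; first by rewrite eqxx.
  - by move=> b; rewrite inE => /orP[/eqP ->|/sp].
  - by rewrite up andbT; apply: contra a1B => /kp.
  - by move=> b; rewrite !inE => /orP[->//|/kp ->]; rewrite orbT.
have [wf sf uf kf] := tab _ fB; split=> // b /kf; rewrite inE => ->.
by rewrite orbT.
Qed.

Lemma path_table_round A s B : {subset s <= A} ->
  path_table A B -> path_table A (round s B).
Proof.
elim: s => //= a s IH sub tab.
apply: path_table_relax; first exact/sub/mem_head.
by apply: IH => // b bs; apply: sub; rewrite inE bs orbT.
Qed.

Lemma path_table_bfs A : path_table A (bfs A).
Proof.
rewrite /bfs; elim: (size A) => [e /mapP[t tT ->]|j IH] //=.
exact: path_table_round.
Qed.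

Lemma unzip1_round s B : {subset unzip1 B <= unzip1 (round s B)}.
Proof.
elim: s => //= a s IH x /IH xB; rewrite unzip1_relax.
by case: ifP; rewrite // inE xB orbT.
Qed.

Lemma mem_bfs A t : t \in Ts -> t \in unzip1 (bfs A).
Proof.
move=> tT; rewrite /bfs; elim: (size A) => [|j IH] /=; last exact: unzip1_round.
by rewrite /unzip1 /init_table -map_comp map_id.
Qed.

Lemma round_step s B a : a \in s -> a.2 \in unzip1 B ->
  a.1 \in unzip1 (round s B).
Proof.
elim: s => //= b s IH; rewrite inE => /orP[/eqP <-|aS] aB; rewrite unzip1_relax.
  by rewrite (unzip1_round s aB) andbT; case: ifPn; rewrite ?mem_head ?negbK.
by case: ifP; rewrite ?inE IH ?orbT.
Qed.

Lemma round_closed A s B : {subset s <= A} -> arc_closed A (unreached B) ->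
  round s B = B.
Proof.
move=> + /allP cl; elim: s => //= a s IH sub.
rewrite IH => [|b bs]; last by apply: sub; rewrite inE bs orbT.
have := cl _ (sub _ (mem_head _ _)).
rewrite /relax /unreached /= -(isSome_assoc a.2).
by case: (a.1 \in _) => //=; case: (assoc _ _).
Qed.

(* A round that is not yet stable discovers the tail of some new arc, so
   [size A] rounds reach a fixpoint. *)
Lemma bfs_closed A : arc_closed A (unreached (bfs A)).
Proof.
pose undiscovered B := count (fun a => unreached B a.1) A.
have fixB : round A (bfs A) = bfs A.
  apply: (iter_fixpoint (phi := undiscovered)) (count_size _ _) => B.
  have [cl|] := boolP (arc_closed A (unreached B)).
    by left; apply: round_closed cl.
  case/allPn => a aA; rewrite negb_imply /= negbK => /andP[a1 a2]; right.
  apply: (count_ltn _ aA) => //=; last by rewrite negbK; apply: round_step.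
  by move=> b _; apply: contra; apply: unzip1_round.
apply/allP => a aA; apply/implyP; rewrite /= -{1}fixB.
by apply: contra; apply: round_step.
Qed.

Lemma bfs_max A Q : arc_closed A Q -> ~~ has Q Ts ->
  subpred Q (unreached (bfs A)).
Proof.
move=> clQ TQ x Qx; apply: contra TQ => /mapP[e eB xe].
have [we se _ _] := path_table_bfs eB.
by apply: walk_closed we se clQ _; rewrite -xe.
Qed.

Lemma size_round s B : size (round s B) <= size B + size s.
Proof.
elim: s => [|a s IH] /=; first by rewrite addn0.
rewrite /relax addnS; case: (_ \in _); first exact: leqW.
by case: (assoc _ _) => [p|]; [rewrite ltnS | apply: leqW].
Qed.

Lemma size_rounds j A :
  size (iter j (round A) init_table) <= size Ts + j * size A.
Proof.
elim: j => [|j IH] /=; first by rewrite size_map addn0.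
by apply: leq_trans (size_round _ _) _; rewrite mulSnr addnA leq_add2r.
Qed.

End BackwardSearch.

(** * Minimum cuts *)

Section Cuts.
Variable V : eqType.
Implicit Types (a : V * V) (A p : arcs V) (R Q : pred V) (B : table V)
  (Ts Src : seq V).

Definition cut_size A R := count (fun a => R a.1 && ~~ R a.2) A.

Lemma cut_size_eq0 A R : (cut_size A R == 0) = arc_closed A R.
Proof.
rewrite eqn0Ngt -has_count -all_predC; apply: eq_all => a /=.
by case: (R a.1) => //=; rewrite negbK.
Qed.

Lemma cut_size_submodular A R Q :
  cut_size A (predI R Q) + cut_size A (predU R Q) <=
    cut_size A R + cut_size A Q.
Proof.
elim: A => //= a A; rewrite /cut_size /=.
by case: (R a.1); case: (R a.2); case: (Q a.1); case: (Q a.2) => /=; lia.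
Qed.

Lemma count_mem_le_cut_size A R a :
  R a.1 -> ~~ R a.2 -> count_mem a A <= cut_size A R.
Proof. by move=> R1 R2; apply: sub_count => b /eqP -> /=; rewrite R1. Qed.

Definition augment A p : arcs V :=
  foldr (fun a A' => (a.2, a.1) :: rem a A') A p.

Lemma mem_augment A p a : a \in A -> a \notin p -> a \in augment A p.
Proof.
elim: p => //= b p IH aA; rewrite inE negb_or => /andP[ab ap].
by rewrite inE rem_mem ?orbT ?IH.
Qed.

Lemma size_augment A p : {subset p <= A} -> uniq p ->
  size (augment A p) = size A.
Proof.
elim: p => //= a p IH sub /andP[ap up].
have aA : a \in augment A p by rewrite mem_augment // sub ?mem_head.
rewrite size_rem // IH => // [|b bp]; last by rewrite sub // inE bp orbT.
by case: (A) (sub _ (mem_head _ _)).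
Qed.

(* Reversing one arc [(x, y)] changes every cut size by [R y - R x], and this
   telescopes along the path. *)
Lemma cut_size_augment Ts A p x R :
  {subset p <= A} -> uniq p -> walk Ts x p -> ~~ has R Ts ->
  cut_size (augment A p) R + R x = cut_size A R.
Proof.
move=> + + + /hasPn TR; elim: p x => [|a p IH] x /=.
  by move=> _ _ /TR /negbTE ->; rewrite addn0.
move=> sub /andP[ap up] /andP[/eqP <- wp].
have aA : a \in augment A p by rewrite mem_augment // sub ?mem_head.
rewrite -(IH a.2) // => [|b bp]; last by rewrite sub // inE bp orbT.
rewrite {1}/cut_size /= count_rem aA -/(cut_size _ R) /=.
have : R a.1 && ~~ R a.2 -> 0 < cut_size (augment A p) R.
  by move=> Ra; rewrite -has_count; apply/hasP; exists a.
by case: (R a.1); case: (R a.2) => //=; lia.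
Qed.

Definition is_cut Src Ts R : bool := all R Src && ~~ has R Ts.

Definition furthest_min_cut A Src Ts R :=
  [/\ is_cut Src Ts R,
      forall Q, is_cut Src Ts Q -> cut_size A R <= cut_size A Q
    & forall Q, is_cut Src Ts Q -> cut_size A Q <= cut_size A R -> subpred Q R].

Definition source_path Src B : option (arcs V) :=
  ohead (pmap (fun x => assoc x B) Src).

Lemma source_path_some Src B p :
  source_path Src B = Some p -> exists2 x, x \in Src & (x, p) \in B.
Proof.
rewrite /source_path => E; have : p \in pmap (fun x => assoc x B) Src.
  by case: (pmap _ _) E => //= q s [->]; rewrite mem_head.
by rewrite mem_pmap => /mapP[x xS /esym/assoc_mem]; exists x.
Qed.

Lemma source_path_none Src B :
  source_path Src B = None -> all (unreached B) Src.
Proof.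
rewrite /source_path; elim: Src => //= x Src IH.
have := isSome_assoc x B; case: (assoc x B) => //= xB /IH ->.
by rewrite andbT /unreached /= -xB.
Qed.

Section Flow.
Variable Ts : seq V.

(* Ford-Fulkerson with the residual network in place of a flow: reversing the
   arcs of an augmenting path lowers every cut by exactly one. *)
Fixpoint flow j A Src : option (table V) :=
  let B := bfs Ts A in
  if source_path Src B is Some p then
    if j is j'.+1 then flow j' (augment A p) Src else None
  else Some B.

Lemma flowE j A Src : flow j A Src =
  if source_path Src (bfs Ts A) is Some p then
    if j is j'.+1 then flow j' (augment A p) Src else None
  else Some (bfs Ts A).
Proof. by case: j. Qed.

Lemma source_path_bfs A Src p : source_path Src (bfs Ts A) = Some p ->
  exists2 x, x \in Src & [/\ walk Ts x p, {subset p <= A}, uniq p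
    & size p <= size (bfs Ts A)].
Proof.
case/source_path_some => x xS /path_table_bfs[wp sub up kp]; exists x => //.
split=> //; first exact: map_uniq up.
by have := uniq_leq_size up kp; rewrite !size_map.
Qed.

Lemma cut_size_source_path A Src p R : source_path Src (bfs Ts A) = Some p ->
  is_cut Src Ts R -> cut_size A R = (cut_size (augment A p) R).+1.
Proof.
move=> /source_path_bfs[x xS [wp sub up _]] /andP[/allP/(_ _ xS) Rx TR].
by rewrite -(cut_size_augment sub up wp TR) Rx addn1.
Qed.

Lemma furthest_min_cut_bfs A Src : source_path Src (bfs Ts A) = None ->
  cut_size A (unreached (bfs Ts A)) = 0 /\
  furthest_min_cut A Src Ts (unreached (bfs Ts A)).
Proof.
move=> noPath; have R0 : cut_size A (unreached (bfs Ts A)) = 0.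
  by apply/eqP; rewrite cut_size_eq0 bfs_closed.
split=> //; split.
- apply/andP; split; first exact: source_path_none.
  by apply/hasPn => t /mem_bfs tB; rewrite /= negbK.
- by rewrite R0.
- by move=> Q /andP[_ TQ]; rewrite R0 leqn0 cut_size_eq0 => clQ; apply: bfs_max.
Qed.

Lemma flow_some j A Src B : flow j A Src = Some B ->
  cut_size A (unreached B) <= j /\ furthest_min_cut A Src Ts (unreached B).
Proof.
elim: j A => [|j IH] A /=; case path_eq: (source_path _ _) => [p|] //.
- by case=> <-; have [-> ?] := furthest_min_cut_bfs path_eq.
- have shift := cut_size_source_path path_eq.
  move=> /IH[le_j [cutB minB maxB]]; split; first by rewrite shift.
  split=> // Q cutQ; rewrite !shift // ltnS.
    exact: minB.
  exact: maxB.
- by case=> <-; have [-> ?] := furthest_min_cut_bfs path_eq.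
Qed.

Lemma flow_none j A Src Q :
  flow j A Src = None -> is_cut Src Ts Q -> j < cut_size A Q.
Proof.
elim: j A => [|j IH] A /=; case path_eq: (source_path _ _) => [p|] // fl cutQ;
  rewrite (cut_size_source_path path_eq cutQ) //.
exact: IH.
Qed.

Lemma size_flow j A Src B :
  flow j A Src = Some B -> size B <= size Ts + size A * size A.
Proof.
elim: j A => [|j IH] A /=; case path_eq: (source_path _ _) => [p|] //.
- by case=> <-; apply: size_rounds.
- have [x _ [_ sub up _]] := source_path_bfs path_eq.
  by move=> /IH; rewrite size_augment.
- by case=> <-; apply: size_rounds.
Qed.

End Flow.
End Cuts.

(** * The vertex-splitting network *)

Lemma count_flatten_nseq (I J : Type) (p : pred J) m (f : I -> J) s :
  count p (flatten [seq nseq m (f x) | x <- s]) = m * count (p \o f) s.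
Proof.
elim: s => [|x s IH] /=; first by rewrite muln0.
by rewrite count_cat count_nseq IH mulnDr mulnC.
Qed.

Definition vals n (A : {set 'I_n}) : seq nat :=
  [seq nat_of_ord u | u <- enum A].

Lemma mem_vals n (A : {set 'I_n}) (u : 'I_n) :
  ((u : nat) \in vals A) = (u \in A).
Proof. by rewrite mem_map ?mem_enum //; apply: val_inj. Qed.

Lemma valsP n (A : {set 'I_n}) (x : nat) :
  reflect (exists2 u : 'I_n, u \in A & x = u) (x \in vals A).
Proof.
by apply: (iffP mapP) => -[u uA ->]; exists u; rewrite ?mem_enum // -mem_enum.
Qed.

Lemma size_vals n (A : {set 'I_n}) : size (vals A) = #|A|.
Proof. by rewrite size_map cardE. Qed.

Lemma vals_uniq n (A : {set 'I_n}) : uniq (vals A).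
Proof. by rewrite map_inj_uniq ?enum_uniq //; apply: val_inj. Qed.

Lemma size_vals_le n (A : {set 'I_n}) : size (vals A) <= n.
Proof. by rewrite size_vals -[leqRHS]card_ord max_card. Qed.

(* Vertex [u] is split into an entry [u] and an exit [n + u]; the arcs that
   must not be cut are repeated [k + 1] times. *)
Definition split_network n (adj : seq (seq nat)) (U : seq nat) k : arcs nat :=
  flatten [seq nseq (if u \in U then k.+1 else 1) (u, n + u) ++
                flatten [seq nseq k.+1 (n + u, w) | w <- nth [::] adj u]
          | u <- iota 0 n].

Definition adjacency (G : digraph) : seq (seq nat) :=
  [seq vals [set w | edge u w] | u <- enum (vertex G)].

Definition network (G : digraph) k : arcs nat :=
  split_network (nb_vertices G) (adjacency G) (vals (undeletable G)) k.

Section Network.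
Variables (G : digraph) (k : nat).
Notation n := (nb_vertices G).
Implicit Types u w : vertex G.

Definition multiplicity u := if u \in undeletable G then k.+1 else 1.

Lemma count_network (p : pred (nat * nat)) : count p (network G k) =
  \sum_(u < n) (multiplicity u * p (u : nat, n + u) +
                k.+1 * count (fun x => p (n + u, x)) (vals [set w | edge u w])).
Proof.
rewrite count_flatten -map_comp sumnE big_map -{1}(subn0 n) -/(index_iota 0 n).
rewrite big_mkord; apply: eq_bigr => u _.
rewrite /comp count_cat count_nseq count_flatten_nseq mem_vals mulnC.
by rewrite (nth_map u) ?size_enum_ord // nth_ord_enum.
Qed.

Lemma count_network_ge (p : pred (nat * nat)) u :
  multiplicity u * p (u : nat, n + u) +
  k.+1 * count (fun x => p (n + u, x)) (vals [set w | edge u w]) <=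
  count p (network G k).
Proof. by rewrite count_network (bigD1 u) //= leq_addr. Qed.

Lemma networkP a : a \in network G k ->
  (exists u w, edge u w /\ a = (n + u, w : nat)) \/
  (exists u, a = (u : nat, n + u)).
Proof.
rewrite -has_pred1 has_count count_network lt0n sum_nat_eq0.
case/forallPn => u /=; rewrite addn_eq0 negb_and !muln_eq0 !negb_or.
case/orP => /andP[_].
  by rewrite eqb0 negbK => /eqP <-; right; exists u.
rewrite -lt0n -has_count => /hasP[_ /valsP[w + ->] /eqP <-].
by rewrite inE => euw; left; exists u, w.
Qed.

Lemma count_edge_arc u w : edge u w ->
  k < count_mem (n + u, w : nat) (network G k).
Proof.
move=> euw; apply: leq_trans (count_network_ge _ u).
apply: leq_trans (leq_addl _ _).
rewrite leq_pmulr // -has_count; apply/hasP.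
by exists (w : nat); rewrite ?mem_vals ?inE //= eqxx.
Qed.

Lemma edge_arc u w : edge u w -> (n + u, w : nat) \in network G k.
Proof.
by rewrite -has_pred1 has_count => /count_edge_arc; apply: leq_ltn_trans.
Qed.

Lemma multiplicity_le_count u : multiplicity u <=
  count_mem (u : nat, n + u) (network G k).
Proof.
apply: leq_trans (count_network_ge _ u).
by rewrite /= eqxx muln1 leq_addr.
Qed.

Lemma vertex_arc u : (u : nat, n + u) \in network G k.
Proof.
rewrite -has_pred1 has_count; apply: leq_trans (multiplicity_le_count u).
by rewrite /multiplicity; case: ifP.
Qed.

Lemma count_deletable_arc u : u \notin undeletable G ->
  count (fun a : nat * nat => a.1 == u) (network G k) = 1.
Proof.
move=> uU; rewrite count_network (bigD1 u) //= /multiplicity (negPf uU) eqxx.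
have noexit w (s : seq nat) : count (fun=> n + w == u) s = 0.
  by rewrite gtn_eqF ?ltn_addr //; elim: s.
rewrite noexit muln0 big1 ?addn0 // => w wu.
rewrite noexit muln0 addn0 (_ : (w == u :> nat) = false) ?muln0 //.
exact: negPf.
Qed.

Lemma size_network : size (network G k) <= k.+1 * (n + n * n).
Proof.
rewrite -(count_predT (network G k)) count_network.
apply: leq_trans (_ : \sum_(u < n) (k.+1 * n.+1) <= _); last first.
  by rewrite big_const_ord iter_addn_0; nia.
apply: leq_sum => u _; rewrite count_predT muln1 mulnS; apply: leq_add.
  by rewrite /multiplicity; case: ifP.
by rewrite leq_mul2l size_vals_le orbT.
Qed.

End Network.

(** * Reachability after deleting vertices *)

Lemma connect_ind (V : finType) (e : rel V) (I : pred V) x y :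
  (forall a b, I a -> e a b -> I b) -> connect e x y -> I x -> I y.
Proof.
move=> step /connectP[p + ->]; elim: p x => //= z p IH x /andP[exz zp] Ix.
by apply: IH zp _; apply: step exz.
Qed.

Section Reachability.
Variable G : digraph.
Implicit Types (A C W : {set vertex G}) (u v w : vertex G).

Lemma mem_reach1 W v u :
  (u \in reach W [set v]) = (v \notin W) && connect (edge_minus W) v u.
Proof.
rewrite inE; apply/exists_inP/idP => [[x]|H]; first by rewrite inE => /eqP ->.
by exists v; rewrite ?inE.
Qed.

Lemma reach1_ind W (I : pred (vertex G)) v u :
  (v \notin W -> I v) ->
  (forall a b, a \in reach W [set v] -> I a -> edge a b -> b \notin W -> I b) ->
  u \in reach W [set v] -> I u.
Proof.
rewrite mem_reach1 => Iv step /andP[vW c].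
suff /andP[] : (u \in reach W [set v]) && I u by [].
apply: (@connect_ind _ _ [pred u | (u \in reach W [set v]) && I u] v u _ c).
  move=> a b /andP[ra Ia] eab; move: (eab) => /and3P[e1 _ bW].
  rewrite /= (step a) // andbT.
  move: ra; rewrite !mem_reach1 => /andP[-> ca] /=.
  exact: connect_trans (connect1 eab).
by rewrite /= mem_reach1 vW connect0 Iv.
Qed.

Lemma reach1_notin W v u : u \in reach W [set v] -> u \notin W.
Proof. exact: (reach1_ind (I := [pred u | u \notin W])). Qed.

Lemma reach1_step W v u w :
  u \in reach W [set v] -> edge u w -> w \notin W -> w \in reach W [set v].
Proof.
move=> ru euw wW; have uW := reach1_notin ru.
move: ru; rewrite !mem_reach1 => /andP[-> c] /=; apply: connect_trans c _.
by apply: connect1; rewrite /edge_minus /= euw uW wW.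
Qed.

Lemma separator_mono A C W W' : W \subset W' ->
  W' \subset ~: (A :|: C :|: undeletable G) ->
  separator A C W -> separator A C W'.
Proof.
move=> /subsetP WW' sub /and5P[A0 C0 dis _ /forall_inP sep].
apply/and5P; split=> //; apply/forall_inP => a aA; apply/forall_inP => c cC.
have /forall_inP/(_ c cC) := sep a aA; apply: contra; apply: connect_sub => x y.
rewrite /edge_minus /= => /and3P[exy xW yW]; apply: connect1.
by rewrite /edge_minus /= exy !(contra (WW' _)).
Qed.

End Reachability.

(** * Enumerating important separators *)

Section Branching.
Variable V : eqType.
Implicit Types (A : arcs V) (B : table V) (Ts D E Src : seq V).

Definition delete_tails A D : arcs V := [seq a <- A | a.1 \notin D].

Lemma eq_delete_tails A D D' : D =i D' -> delete_tails A D = delete_tails A D'.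
Proof. by move=> eqD; apply: eq_filter => a; rewrite eqD. Qed.

Definition crossing_arc A B : option (V * V) :=
  ohead [seq a <- A | unreached B a.1 && ~~ unreached B a.2].

Lemma crossing_arc_some A B a : crossing_arc A B = Some a ->
  [/\ a \in A, unreached B a.1 & ~~ unreached B a.2].
Proof.
rewrite /crossing_arc => E.
suff : a \in [seq b <- A | unreached B b.1 && ~~ unreached B b.2].
  by rewrite mem_filter => /andP[/andP[]].
by case: (filter _ _) E => //= b s [->]; rewrite mem_head.
Qed.

Lemma crossing_arc_none A B : crossing_arc A B = None ->
  arc_closed A (unreached B).
Proof.
move=> E; rewrite -cut_size_eq0 /cut_size -size_filter.
by move: E; rewrite /crossing_arc; case: (filter _ _).
Qed.

Fixpoint separator_tree A Ts k j D Src : seq (seq V) :=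
  if j is j'.+1 then
    if flow Ts k (delete_tails A D) Src is Some B then
      if crossing_arc (delete_tails A D) B is Some a then
        separator_tree A Ts k j' (a.1 :: D) Src ++
        separator_tree A Ts k j' D (a.2 :: Src)
      else [:: D]
    else [::]
  else [::].

Lemma size_separator_tree A Ts k j D Src :
  size (separator_tree A Ts k j D Src) <= 2 ^ j.
Proof.
elim: j D Src => [|j IH] D Src //=; rewrite expnS.
have : 0 < 2 ^ j by rewrite expn_gt0.
case: flow => [B|] //=; case: crossing_arc => [a|] /=; last by lia.
by rewrite size_cat; move: (IH (a.1 :: D) Src) (IH D (a.2 :: Src)); lia.
Qed.

Lemma size_mem_separator_tree A Ts k j D Src E :
  E \in separator_tree A Ts k j D Src -> size E <= size D + j.
Proof.
elim: j D Src => [|j IH] D Src //=.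
case: flow => [B|] //; case: crossing_arc => [a|].
  by rewrite mem_cat addnS => /orP[/IH|/IH/leqW].
by rewrite inE => /eqP ->; rewrite leq_addr.
Qed.

End Branching.

Section SeparatorTree.
Variables (G : digraph) (T : {set vertex G}) (k : nat).
Notation n := (nb_vertices G).
Notation net_minus := (delete_tails (network G k)).
Notation tree := (separator_tree (network G k) (vals T) k).
Implicit Types (D E Src : seq nat) (Q : pred nat) (u v w : vertex G).

Definition vset D : {set vertex G} := [set u : vertex G | (u : nat) \in D].

Definition removable v D := forall x, x \in D ->
  exists2 u : vertex G, u \in ~: ([set v] :|: T :|: undeletable G) & x = u.

Lemma vset_removable v D : removable v D ->
  vset D \subset ~: ([set v] :|: T :|: undeletable G).
Proof.
by move=> rD; apply/subsetP => u; rewrite inE => /rD[w wP /val_inj ->].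
Qed.

Lemma removable_lt v D x : removable v D -> x \in D -> x < n.
Proof. by move=> rD /rD[u _ ->]. Qed.

Lemma exit_notin v u D : removable v D -> n + u \notin D.
Proof.
by move=> rD; apply/negP => /(removable_lt rD); rewrite ltnNge leq_addr.
Qed.

Lemma arc_closed_delete A D Q a : arc_closed (delete_tails A D) Q ->
  a \in A -> a.1 \notin D -> Q a.1 -> Q a.2.
Proof. by move=> /allP cl aA aD; apply/implyP/cl; rewrite mem_filter aD. Qed.

Lemma closed_separator v D Q : T != set0 -> v \notin T -> removable v D ->
  arc_closed (net_minus D) Q -> Q (n + v) -> ~~ has Q (vals T) ->
  separator [set v] T (vset D).
Proof.
move=> T0 vT rD cl Qv /hasPn TQ; apply/and5P; split=> //.
- by apply/set0Pn; exists v; rewrite inE.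
- by rewrite disjoints1.
- exact: vset_removable.
apply/forall_inP => a; rewrite inE => /eqP ->; apply/forall_inP => t tT.
pose inside := [pred u : vertex G | (u == v) || Q u && Q (n + u)].
have step u w : inside u -> edge_minus (vset D) u w -> inside w.
  move=> /= Iu; rewrite /edge_minus /= !inE => /and3P[euw uD wD].
  have Qu : Q (n + u) by case/orP: Iu => [/eqP ->//|/andP[]].
  have Qw : Q w := arc_closed_delete cl (edge_arc k euw) (exit_notin u rD) Qu.
  by rewrite Qw (arc_closed_delete cl (vertex_arc k w)) ?orbT.
apply/negP => vt; have := connect_ind step vt; rewrite /= eqxx.
case/(_ isT)/orP => [/eqP tv|/andP[Qt _]]; first by rewrite tv (negPf vT) in tT.
by have /TQ := introT (valsP T t) (ex_intro2 _ _ t tT erefl); rewrite Qt.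
Qed.

Lemma crossing_vertex D Q a : cut_size (net_minus D) Q <= k ->
  a \in net_minus D -> Q a.1 -> ~~ Q a.2 ->
  exists u, [/\ a = (u : nat, n + u),
    u \notin undeletable G & (u : nat) \notin D].
Proof.
move=> le; rewrite mem_filter => /andP[aD aN] Q1 Q2.
have small : count_mem a (network G k) <= k.
  apply: leq_trans (leq_trans (count_mem_le_cut_size (net_minus D) Q1 Q2) le).
  rewrite count_filter; apply/eq_leq/eq_in_count => b _ /=.
  by case: eqP => //= ->; rewrite aD.
case: (networkP aN) => [[u [w [euw ea]]]|[u ea]].
  by have := count_edge_arc k euw; rewrite -ea ltnNge small.
exists u; split=> //; last by rewrite ea in aD.
apply: contraTN small => uU; rewrite -ltnNge ea.
by apply: leq_trans (multiplicity_le_count k u); rewrite /multiplicity uU.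
Qed.

Lemma cut_size_cons u D Q : u \notin undeletable G ->
  cut_size (net_minus D) Q <= (cut_size (net_minus ((u : nat) :: D)) Q).+1.
Proof.
move=> /(count_deletable_arc k) one_arc; rewrite -addn1 -one_arc.
rewrite /cut_size !count_filter.
rewrite -(count_predUI _ (fun a : nat * nat => a.1 == u)).
apply: leq_trans (leq_addr _ _); apply: sub_count => a /=.
by rewrite inE; case: (_ == _); case: (Q a.1) => //=; rewrite ?orbF ?orbT.
Qed.

Lemma cut_size_cat v E D Q : removable v E ->
  cut_size (net_minus D) Q <= cut_size (net_minus (E ++ D)) Q + size E.
Proof.
elim: E => [|x E IH] rE /=; first by rewrite addn0.
have /IH/leq_trans : removable v E.
  by move=> y yE; apply: rE; rewrite inE yE orbT.
have [u + ->] := rE x (mem_head _ _); rewrite !inE !negb_or => /andP[_ uU].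
by apply; rewrite addnS -addSn leq_add2r; apply: cut_size_cons.
Qed.

Lemma removable_cons v u D Src B : removable v D -> u \notin undeletable G ->
  is_cut Src (vals T) (unreached B) -> n + v \in Src ->
  unreached B u -> ~~ unreached B (n + u) -> removable v ((u : nat) :: D).
Proof.
move=> rD uU /andP[/allP cS /hasPn cT] vS u1 u2 x.
rewrite inE => /orP[/eqP ->|/rD //]; exists u => //.
rewrite !inE (negPf uU) orbF negb_or; apply/andP; split.
  by apply: contraNneq u2 => ->; apply: cS.
by apply: contraL u1 => uT; apply: cT; rewrite mem_vals.
Qed.

Lemma separator_tree_sound v j D Src E : T != set0 -> v \notin T ->
  removable v D -> n + v \in Src -> E \in tree j D Src ->
  removable v E /\ separator [set v] T (vset E).
Proof.
move=> T0 vT; elim: j D Src => [|j IH] D Src rD vS //=.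
case flow_eq: flow => [B|] //; have [le [cutB _ _]] := flow_some flow_eq.
case cross_eq: crossing_arc => [a|]; last first.
  rewrite inE => /eqP ->; split=> //; have /andP[/allP cS cT] := cutB.
  exact: closed_separator (crossing_arc_none cross_eq) (cS _ vS) cT.
have [aD a1 a2] := crossing_arc_some cross_eq.
have [u [ea uU uD]] := crossing_vertex le aD a1 a2.
rewrite mem_cat => /orP[]; last by apply: IH; rewrite // inE vS orbT.
rewrite ea in a1 a2 *; apply: IH => //; exact: removable_cons cutB vS a1 a2.
Qed.

(** ** Every important separator occurs *)

Section NearSide.
Variables (v : vertex G) (S : {set vertex G}).

(* Entries and exits of the split network that [v] reaches in [G \ S]. *)
Definition near_side : seq nat :=
  vals (reach S [set v] :|: S) ++ [seq n + x | x <- vals (reach S [set v])].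

Lemma near_side_entry u :
  ((u : nat) \in near_side) = (u \in reach S [set v]) || (u \in S).
Proof.
rewrite mem_cat mem_vals in_setU orb_idr // => /mapP[x _ ux].
by have := ltn_ord u; rewrite ux ltnNge leq_addr.
Qed.

Lemma near_side_exit u : (n + u \in near_side) = (u \in reach S [set v]).
Proof.
rewrite mem_cat (mem_map (@addnI n)) mem_vals orb_idl // => /valsP[w _ uw].
by have := ltn_ord w; rewrite -uw ltnNge leq_addr.
Qed.

Lemma near_side_closed : arc_closed (net_minus (vals S)) (mem near_side).
Proof.
apply/allP => a; rewrite mem_filter => /andP[aS aN]; apply/implyP.
case: (networkP aN) aS => [[u [w [euw ->]]] _|[u ->]] /=.
  rewrite near_side_exit near_side_entry => ru.
  have [|wS] := boolP (w \in S); rewrite ?orbT // orbF.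
  exact: reach1_step euw wS.
by rewrite mem_vals near_side_entry near_side_exit => /negPf ->; rewrite orbF.
Qed.

Lemma near_side_targets : separator [set v] T S ->
  ~~ has (mem near_side) (vals T).
Proof.
move=> /and5P[_ _ _ /subsetP subS /forall_inP sep].
apply/hasPn => _ /valsP[t tT ->]; rewrite /= near_side_entry negb_or.
apply/andP; split.
  by rewrite mem_reach1 negb_and (forall_inP (sep v (set11 v)) t tT) orbT.
by apply: contraL tT => /subS; rewrite !inE !negb_or => /andP[/andP[_ ->]].
Qed.

End NearSide.

Section ImportantSeparator.
Variables (v : vertex G) (S : {set vertex G}).
Hypothesis impS : important_separator [set v] T S.
Hypothesis cardS : #|S| <= k.

(* The furthest set containing [v], avoiding [T] and closed in [G \ S]. *)
Let far_side : pred nat := unreached (bfs (vals T) (net_minus (vals S))).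

Lemma important_is_separator : separator [set v] T S.
Proof. by case: impS => [[]]. Qed.

Lemma important_targets : T != set0.
Proof. by case/and5P: important_is_separator. Qed.

Lemma important_source_notin_targets : v \notin T.
Proof. by case/and5P: important_is_separator => _ _; rewrite disjoints1. Qed.

Lemma important_sub : S \subset ~: ([set v] :|: T :|: undeletable G).
Proof. by case/and5P: important_is_separator. Qed.

Lemma important_removable : removable v (vals S).
Proof.
by move=> _ /valsP[u uS ->]; exists u => //; apply: (subsetP important_sub).
Qed.

Lemma important_source_notin : v \notin S.
Proof. by apply/negP => /(subsetP important_sub); rewrite !inE eqxx. Qed.

Lemma far_side_closed : arc_closed (net_minus (vals S)) far_side.
Proof. exact: bfs_closed. Qed.

Lemma far_side_targets : ~~ has far_side (vals T).
Proof. by apply/hasPn => t tT; rewrite /= negbK mem_bfs. Qed.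

Lemma near_far : {subset near_side v S <= far_side}.
Proof.
exact: bfs_max (near_side_closed v S)
  (near_side_targets important_is_separator).
Qed.

Lemma reach_source : v \in reach S [set v].
Proof. by rewrite mem_reach1 important_source_notin connect0. Qed.

Lemma far_side_source : far_side v /\ far_side (n + v).
Proof.
by split; apply: near_far; rewrite ?near_side_entry ?near_side_exit
  reach_source.
Qed.

Lemma important_minimal D : removable v D -> {subset D <= vals S} ->
  separator [set v] T (vset D) -> vset D = S.
Proof.
move=> rD sub sepD; have subD : vset D \subset S.
  by apply/subsetP => u; rewrite inE => /sub; rewrite mem_vals.
case: (eqVproper subD) => // pr.
by case: impS => -[_ /(_ _ pr)]; rewrite sepD.
Qed.

Lemma important_tight u : u \in S ->
  exists2 w, w \in reach S [set v] & edge w u.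
Proof.
move=> uS; apply/exists_inP; apply: contraTT isT => /exists_inPn no.
case: impS => -[/and5P[v0 _ dis sub sep] minS] _.
case/negP: (minS _ (properD1 uS)); apply/and5P; split=> //.
- exact: important_targets.
- by apply: subset_trans sub; apply: subD1set.
apply/forall_inP => a; rewrite inE => /eqP ->; apply/forall_inP => t tT.
apply/negP => c; suff : t \in reach S [set v].
  have unreachable := negPf (forall_inP (forall_inP sep v (set11 v)) t tT).
  by rewrite mem_reach1 unreachable andbF.
apply: (reach1_ind (W := S :\ u) (I := mem (reach S [set v])) (v := v)) =>
    [_|a' b _ /= ra eab|].
- exact: reach_source.
- rewrite in_setD1 negb_and negbK => /orP[/eqP bu|]; last first.
    exact: reach1_step eab.
  by have := no _ ra; rewrite -bu eab.
- by rewrite mem_reach1 c !inE (negPf important_source_notin) andbF.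
Qed.

Section FurtherCut.
Variables (D : seq nat) (Q : pred nat).
Hypothesis subD : {subset D <= vals S}.
Hypothesis subQ : subpred far_side Q.
Hypothesis targetsQ : ~~ has Q (vals T).
Hypothesis sizeQ : cut_size (net_minus D) Q + size D <= #|S|.

Let tails := [seq a.1 | a <- net_minus D & Q a.1 && ~~ Q a.2].
Let S' := vset (tails ++ D).

Lemma tailsP x : x \in tails ->
  exists u, [/\ x = u, u \notin undeletable G, Q u & ~~ Q (n + u)].
Proof.
case/mapP => a; rewrite mem_filter => /andP[/andP[a1 a2] aD] ->.
have [|u [ea uU _]] := crossing_vertex _ aD a1 a2.
  by apply: leq_trans cardS; apply: leq_trans sizeQ; apply: leq_addr.
by rewrite ea /= in a1 a2 *; exists u.
Qed.

Lemma tails_removable : removable v (tails ++ D).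
Proof.
move=> x; rewrite mem_cat => /orP[|/subD/important_removable //].
case/tailsP => u [-> uU Qu nQ].
exists u => //; rewrite !inE (negPf uU) orbF negb_or; apply/andP; split.
  by apply: contraNneq nQ => ->; apply: subQ; case: far_side_source.
by apply: contraL Qu => uT; apply: (hasPn targetsQ); rewrite mem_vals.
Qed.

Lemma tails_closed : arc_closed (net_minus (tails ++ D)) Q.
Proof.
apply/allP => a; rewrite mem_filter mem_cat negb_or -andbA => /and3P[aE aD aN].
apply/implyP => Qa; apply: contraR aE => nQ.
by apply: map_f; rewrite !mem_filter Qa nQ aD aN.
Qed.

Lemma tails_separator : separator [set v] T S'.
Proof.
apply: closed_separator tails_removable tails_closed _ targetsQ.
- exact: important_targets.
- exact: important_source_notin_targets.
- by apply: subQ; case: far_side_source.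
Qed.

Lemma card_tails : #|S'| <= #|S|.
Proof.
apply: leq_trans sizeQ.
have <- : size (tails ++ D) = cut_size (net_minus D) Q + size D.
  by rewrite size_cat size_map size_filter.
rewrite -size_vals; apply: uniq_leq_size (vals_uniq _) _.
by move=> x /valsP[u]; rewrite inE => uE ->.
Qed.

Lemma reach_tails : reach S [set v] \subset reach S' [set v].
Proof.
have notin_S' u : u \in reach S [set v] -> u \notin S'.
  move=> ru; rewrite inE mem_cat negb_or; apply/andP; split.
    apply/negP => /tailsP[w [/val_inj <- _ _ /negP[]]].
    by apply/subQ/near_far; rewrite near_side_exit.
  by apply: contra (reach1_notin ru) => /subD; rewrite mem_vals.
apply/subsetP => u; apply: (reach1_ind (I := mem (reach S' [set v]))) =>
    [_|a b ra /= ra' eab bS].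
  by rewrite /= mem_reach1 notin_S' ?reach_source ?connect0.
exact: reach1_step ra' eab (notin_S' b (reach1_step ra eab bS)).
Qed.

Lemma tailsE : tails ++ D =i vals S.
Proof.
have eqR : reach S [set v] = reach S' [set v].
  case: (eqVproper reach_tails) => // pr; case: impS => _ []; exists S'.
  by split; [exact: tails_separator | exact: card_tails | exact: pr].
have subS : S \subset S'.
  apply/subsetP => u uS; have [w rw ewu] := important_tight uS.
  apply: contraLR uS => uS'; apply: (@reach1_notin _ _ v).
  by rewrite eqR; apply: reach1_step ewu uS'; rewrite -eqR.
have eqS : S = S' by apply/eqP; rewrite eqEcard subS card_tails.
move=> x; apply/idP/valsP => [xE|[u]]; last by rewrite {1}eqS inE => uE ->.
by have [u _ xu] := tails_removable xE; exists u; rewrite // eqS inE -xu.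
Qed.

(* The tails crossing [Q], together with [D], form a separator [S'] no larger
   than [S] and pushed at least as far; importance of [S] forces [S' = S], so
   [Q] is closed in [G \ S]. *)
Lemma further_cut : subpred Q far_side.
Proof.
by apply: bfs_max targetsQ; rewrite -(eq_delete_tails _ tailsE);
  apply: tails_closed.
Qed.

End FurtherCut.

Lemma cut_far_side Src : all far_side Src -> is_cut Src (vals T) far_side.
Proof. by move=> inS; apply/andP; split=> //; apply: far_side_targets. Qed.

Lemma cut_size_far_side D : uniq D -> {subset D <= vals S} ->
  cut_size (net_minus D) far_side + size D <= #|S|.
Proof.
move=> uD Ds; pose E := [seq x <- vals S | x \notin D].
have eqED : E ++ D =i vals S.
  move=> x; rewrite mem_cat mem_filter.
  by case: (boolP (x \in D)) => [/Ds ->|]; rewrite ?orbF.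
have rE : removable v E.
  by move=> x; rewrite mem_filter => /andP[_ /important_removable].
have := cut_size_cat D far_side rE; rewrite (eq_delete_tails _ eqED).
rewrite (eqP (_ : cut_size (net_minus (vals S)) _ == 0)); last first.
  by rewrite cut_size_eq0 far_side_closed.
rewrite -size_vals; have -> : size (vals S) = size (E ++ D).
  apply/esym/perm_size/uniq_perm => //; last exact: vals_uniq.
  rewrite cat_uniq uD filter_uniq ?vals_uniq //= andbT; apply/hasPn => x xD.
  by rewrite mem_filter xD.
by rewrite size_cat leq_add2r.
Qed.

Definition on_track D Src :=
  [/\ uniq D, {subset D <= vals S}, all far_side Src & n + v \in Src].

Lemma flow_on_track D Src : on_track D Src ->
  exists B, flow (vals T) k (net_minus D) Src = Some B.
Proof.
case=> uD Ds inS _; case flow_eq: flow => [B|]; first by exists B.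
have := flow_none flow_eq (cut_far_side inS); have := cut_size_far_side uD Ds.
by move: cardS; clear; lia.
Qed.

Lemma furthest_far_side D Src R : on_track D Src ->
  furthest_min_cut (net_minus D) Src (vals T) R -> subpred R far_side.
Proof.
case=> uD Ds inS _ [cutR minR _].
have /andP[R1 R2] := cutR; have leF := cut_size_far_side uD Ds.
suff far : subpred (predU R far_side) far_side.
  by move=> x Rx; apply: far; rewrite /= Rx.
apply: further_cut Ds _ _ _.
- by move=> x Fx; rewrite /= Fx orbT.
- by rewrite has_predU negb_or R2 far_side_targets.
have /minR minRF : is_cut Src (vals T) (predI R far_side).
  rewrite /is_cut all_predI R1 inS /=; apply: contra R2.
  by apply: sub_has => x /andP[].
have := cut_size_submodular (net_minus D) R far_side.
by move: minRF leF; clear; lia.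
Qed.

Lemma on_track_leaf D Src R : on_track D Src -> is_cut Src (vals T) R ->
  arc_closed (net_minus D) R -> vset D = S.
Proof.
move=> [_ Ds _ vS] /andP[/allP cS cT] cl.
have rD : removable v D by move=> x /Ds/important_removable.
apply: important_minimal => //.
exact: closed_separator important_targets important_source_notin_targets rD cl
  (cS _ vS) cT.
Qed.

Lemma on_track_delete D Src u :
  on_track D Src -> u \in S -> (u : nat) \notin D ->
  on_track ((u : nat) :: D) Src.
Proof.
move=> [uD Ds inS vS] uS uD'; split; rewrite ?vS //= ?uD ?uD' //.
by move=> x; rewrite inE => /orP[/eqP ->|/Ds //]; rewrite mem_vals.
Qed.

Lemma on_track_push D Src u : on_track D Src -> u \notin S -> far_side u ->
  on_track D (n + u :: Src).
Proof.
move=> [uD Ds inS vS] uS fu; split=> //; last by rewrite inE vS orbT.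
rewrite /= inS andbT.
apply: (arc_closed_delete far_side_closed (vertex_arc k u)) fu.
by rewrite /= mem_vals.
Qed.

(* Branching on a crossing vertex either puts a vertex of [S] into [D], which
   lowers the minimum cut by at most one, or enlarges the minimum cut. *)
Lemma separator_tree_complete j D Src l : on_track D Src ->
  (forall Q, is_cut Src (vals T) Q -> l <= cut_size (net_minus D) Q) ->
  2 * (#|S| - size D) < j + l -> exists2 E, E \in tree j D Src & vset E = S.
Proof.
elim: j D Src l => [|j IH] D Src l track lP lt.
  case: track => uD Ds inS _; have := lP _ (cut_far_side inS).
  by have := cut_size_far_side uD Ds; move: lt; clear; lia.
have [B flow_eq] := flow_on_track track; rewrite /= flow_eq.
have [le furthestB] := flow_some flow_eq; have [cutB minB maxB] := furthestB.
case cross_eq: crossing_arc => [a|]; last first.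
  exists D; first exact: mem_head.
  exact: on_track_leaf cutB (crossing_arc_none cross_eq).
have [aD a1 a2] := crossing_arc_some cross_eq.
have [u [ea uU uD]] := crossing_vertex le aD a1 a2; rewrite ea /= in a1 a2 *.
have cut_gt0 : 0 < cut_size (net_minus D) (unreached B).
  by rewrite lt0n cut_size_eq0; apply/allPn; exists a; rewrite // ea /= a1.
have [uS|uS] := boolP (u \in S).
  have track' := on_track_delete track uS uD.
  have ltD : size D < #|S|.
    case: track' => uD' Ds' _ _.
    by have := uniq_leq_size uD' Ds'; rewrite size_vals.
  have [||E Et <-] := IH _ _ (cut_size (net_minus D) (unreached B)).-1 track'.
  - move=> Q /minB; have := cut_size_cons D Q uU; move: cut_gt0; clear; lia.
  - by move: (lP _ cutB) lt cut_gt0 ltD; rewrite /=; clear; lia.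
  by exists E; rewrite // mem_cat Et.
have track' := on_track_push track uS (furthest_far_side track furthestB a1).
have [||E Et <-] := IH _ _ (cut_size (net_minus D) (unreached B)).+1 track'.
- move=> Q /andP[/= /andP[Qu QS] QT]; rewrite ltnNge; apply/negP.
  by move/(maxB Q (introT andP (conj QS QT)))/(_ _ Qu); rewrite (negPf a2).
- by move: (lP _ cutB) lt; clear; lia.
by exists E; rewrite // mem_cat Et orbT.
Qed.

End ImportantSeparator.

Definition separator_list (x : nat) : seq (seq nat) :=
  tree (2 * k).+1 [::] [:: x; n + x].

Lemma separator_list_sound v D : T != set0 -> v \notin T ->
  D \in separator_list v ->
  removable v D /\ separator [set v] T (vset D).
Proof.
by move=> T0 vT; apply: separator_tree_sound; rewrite // !inE eqxx orbT.
Qed.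

Lemma separator_list_complete v S :
  important_separator [set v] T S -> #|S| <= k ->
  exists2 D, D \in separator_list v & vset D = S.
Proof.
move=> impS cardS; have [fv fnv] := far_side_source impS.
apply: (separator_tree_complete impS cardS (l := 0)) => //.
  by split; rewrite //= ?fv ?fnv // !inE eqxx orbT.
by rewrite subn0 addn0 ltnS leq_mul2l.
Qed.

Lemma size_separator_list x : size (separator_list x) <= 2 ^ (2 * k + 1).
Proof. by rewrite addn1; apply: size_separator_tree. Qed.

End SeparatorTree.

(** * Greedy hashing *)

Section PairSums.
Implicit Types (E F : Type).

Fixpoint pairsum E (f : E -> E -> nat) (s : seq E) : nat :=
  if s is x :: s' then \sum_(y <- s') f x y + pairsum f s' else 0.

Lemma pairsum_map E F (g : E -> F) f s :
  pairsum f (map g s) = pairsum (fun x y => f (g x) (g y)) s.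
Proof. by elim: s => //= x s ->; rewrite big_map. Qed.

Lemma eq_in_pairsum (E : eqType) (f g : E -> E -> nat) s :
  {in s &, f =2 g} -> pairsum f s = pairsum g s.
Proof.
elim: s => //= x s IH eqf; congr (_ + _).
  by apply: eq_big_seq => y ys; apply: eqf; rewrite inE ?eqxx ?ys ?orbT.
by apply: IH => y z ys zs; apply: eqf; rewrite inE ?ys ?zs orbT.
Qed.

Lemma pairsumD E (f g : E -> E -> nat) s :
  pairsum (fun x y => f x y + g x y) s = pairsum f s + pairsum g s.
Proof. by elim: s => //= x s ->; rewrite big_split /= addnACA. Qed.

Lemma pairsum1_le E (s : seq E) : pairsum (fun _ _ => 1) s <= size s ^ 2.
Proof. by elim: s => //= x s; rewrite sum1_size; nia. Qed.

Lemma leq_pairsum (E : eqType) (f : E -> E -> nat) s x y :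
  (forall x y, f x y = f y x) -> x \in s -> y \in s -> x != y ->
  f x y <= pairsum f s.
Proof.
move=> fC; have le_sum z t u : z \in t -> f u z <= \sum_(y <- t) f u y.
  by move=> zt; rewrite (big_rem z) //= leq_addr.
elim: s => //= z s IH; rewrite !inE => /orP[/eqP ->|xs] /orP[/eqP ->|ys] xy.
- by rewrite eqxx in xy.
- exact: leq_trans (le_sum _ _ _ ys) (leq_addr _ _).
- by rewrite fC; apply: leq_trans (le_sum _ _ _ xs) (leq_addr _ _).
- exact: leq_trans (IH xs ys xy) (leq_addl _ _).
Qed.

End PairSums.

Lemma leq_sum_fibers (I : Type) (J : eqType) (s : seq J) (t : seq I)
    (f : I -> J) w :
  uniq s -> \sum_(j <- s) \sum_(i <- t | f i == j) w i <= \sum_(i <- t) w i.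
Proof.
move=> us; rewrite (exchange_big_dep predT) //=; apply: leq_sum => i _.
rewrite big_const_seq iter_addn_0 (eq_count (a2 := pred1 (f i))); last first.
  by move=> j; rewrite /= eq_sym.
by rewrite count_uniq_mem //; case: (_ \in s); rewrite ?muln1 ?muln0.
Qed.

Lemma expS_bernoulli q r : r <= q.+1 -> q.+1 ^ r * (q.+1 - r) <= q ^ r * q.+1.
Proof.
elim: r => [|r IH] lt; first by rewrite subn0.
apply: leq_trans (_ : q * (q.+1 ^ r * (q.+1 - r)) <= _); last first.
  by rewrite expnS -mulnA leq_mul2l IH ?orbT // ltnW.
rewrite expnS -mulnA mulnCA [leqRHS]mulnCA leq_mul2l.
by apply/orP; right; nia.
Qed.

Lemma expS_double q r : 0 < q -> 2 * r <= q -> q.+1 ^ r <= 2 * q ^ r.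
Proof.
move=> q0 le; have := @expS_bernoulli q r ltac:(lia) => bern.
have : q.+1 ^ r * q.+1 <= 2 * q ^ r * q.+1.
  apply: leq_trans (_ : 2 * (q.+1 ^ r * (q.+1 - r)) <= _); last by lia.
  by rewrite mulnCA leq_mul2l; apply/orP; right; lia.
by rewrite leq_mul2r.
Qed.

Section GreedyHashing.
Variables (K : eqType) (colors : seq nat) (vs : seq K).
Implicit Types (x y : K) (h : seq (K * nat)) (H : seq (seq (K * nat))).

Definition color h x := odflt 0 (assoc x h).

Definition weight H x y := 2 ^ count (fun h => color h x == color h y) H.

Definition cost H h x c := \sum_(e <- h | e.2 == c) weight H x e.1.

Definition cheapest H h x :=
  foldr (fun c b => if cost H h x c < cost H h x b then c else b) 0 colors.

Definition new_hash H := foldr (fun x h => (x, cheapest H h x) :: h) [::] vs.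

Definition hash_family L := iter L (fun H => new_hash H :: H) [::].

Lemma weightC H x y : weight H x y = weight H y x.
Proof. by congr (_ ^ _); apply: eq_count => h; rewrite eq_sym. Qed.

Lemma cheapest_min H h x c :
  c \in colors -> cost H h x (cheapest H h x) <= cost H h x c.
Proof.
rewrite /cheapest; elim: colors => //= d s IH.
rewrite inE => /orP[/eqP ->|/IH le].
  by case: ltnP.
by case: ltnP => // /ltnW lt; apply: leq_trans lt le.
Qed.

Lemma mem_cheapest H h x : cheapest H h x \in 0 :: colors.
Proof.
rewrite /cheapest; elim: colors => //= c s; rewrite !inE.
by case: ifP => _; [rewrite eqxx orbT | case/orP => ->; rewrite ?orbT].
Qed.

Lemma cost_cheapest H h x : uniq colors ->
  size colors * cost H h x (cheapest H h x) <= \sum_(e <- h) weight H x e.1.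
Proof.
move=> uc; apply: leq_trans (leq_sum_fibers h snd (fun e => weight H x e.1) uc).
rewrite -sum1_size big_distrl /= big_seq [leqRHS]big_seq.
by apply: leq_sum => c /cheapest_min le; rewrite mul1n.
Qed.

Lemma unzip1_new_hash H : unzip1 (new_hash H) = vs.
Proof. by rewrite /new_hash; elim: vs => //= x s ->. Qed.

Lemma size_new_hash H : size (new_hash H) = size vs.
Proof. by rewrite -(size_map fst) -/(unzip1 _) unzip1_new_hash. Qed.

Lemma color_new_hash H x : color (new_hash H) x \in 0 :: colors.
Proof.
rewrite /color; case E: (assoc _ _) => [c|]; last exact: mem_head.
move/assoc_mem: E; rewrite /new_hash; elim: vs => //= y s IH.
by rewrite inE => /orP[/eqP[_ ->]|/IH //]; apply: mem_cheapest.
Qed.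

Definition potential H := pairsum (weight H) vs.

Lemma potential_new_hash H : uniq colors -> uniq vs ->
  size colors * potential (new_hash H :: H) <= (size colors).+1 * potential H.
Proof.
move=> uc uv; rewrite /potential -(unzip1_new_hash H) !pairsum_map.
set h := new_hash H; have uh : uniq (unzip1 h) by rewrite unzip1_new_hash.
rewrite (eq_in_pairsum (g := fun e e' => weight H e.1 e'.1 +
    if e.2 == e'.2 then weight H e.1 e'.1 else 0)); last first.
  move=> e e' eh eh'; rewrite {1}/weight /= /color !assoc_uniq //=.
  by case: eqP => _; rewrite ?addn0 // expnS mul2n -addnn.
rewrite pairsumD mulnDr mulSn addnC leq_add2r /h /new_hash.
elim: vs => [|x s IH] /=; first by rewrite muln0.
rewrite mulnDr leq_add //; apply: leq_trans (cost_cheapest H _ x uc).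
by rewrite /cost [X in _ <= _ * X]big_mkcond; under eq_bigr do rewrite eq_sym.
Qed.

Lemma potential_hash_family L : uniq colors -> uniq vs ->
  size colors ^ L * potential (hash_family L) <=
    (size colors).+1 ^ L * size vs ^ 2.
Proof.
move=> uc uv; elim: L => [|L IH]; first by rewrite !mul1n pairsum1_le.
rewrite expnSr -mulnA.
apply: leq_trans (leq_mul (leqnn _) (potential_new_hash _ uc uv)) _.
by rewrite mulnCA [_.+1 ^ L.+1]expnS -mulnA leq_mul.
Qed.

Section Separation.
Variables M l : nat.
Hypothesis colors_uniq : uniq colors.
Hypothesis vs_uniq : uniq vs.
Hypothesis M_gt0 : 0 < M.
Hypothesis many_colors : 4 * M <= size colors.
Hypothesis few_vertices : size vs <= 2 ^ l.

Let H := hash_family (2 * M * (2 * l + 1)).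

Lemma count_collisions x y : x \in vs -> y \in vs -> x != y ->
  count (fun h => color h x == color h y) H <= 4 * l + 1.
Proof.
move=> xv yv xy; pose q := size colors.
have q0 : 0 < q by apply: leq_trans many_colors; rewrite muln_gt0.
rewrite -(@leq_exp2l 2) // -/(weight H x y).
apply: leq_trans (leq_pairsum (weightC H) xv yv xy) _.
rewrite -(@leq_pmul2l (q ^ (2 * M * (2 * l + 1)))); last by rewrite expn_gt0 q0.
apply: leq_trans (potential_hash_family _ colors_uniq vs_uniq) _; rewrite -/q.
have -> : 4 * l + 1 = (2 * l + 1) + l * 2 by lia.
rewrite expnD mulnA leq_mul //; last by rewrite expnM leq_exp2r.
rewrite [q.+1 ^ _]expnM [q ^ _]expnM -expnMn leq_exp2r; last by rewrite addn1.
rewrite [leqRHS]mulnC; apply: expS_double => //.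
by apply: leq_trans many_colors; rewrite mulnA.
Qed.

Lemma separating_hash (X Y : seq K) : {subset X <= vs} -> {subset Y <= vs} ->
  ~~ has (mem X) Y -> size X * size Y <= M ->
  exists2 h, h \in H & {in X & Y, forall x y, color h x != color h y}.
Proof.
move=> sX sY dis le.
pose bad h := has (fun x => has (fun y => color h x == color h y) Y) X.
have sizeH : size H = 2 * M * (2 * l + 1).
  by rewrite /H /hash_family; elim: (_ * _) => //= L ->.
have [/hasP[h hH nbad]|] := boolP (has (predC bad) H).
  exists h => // x y xX yY; apply: contra nbad => c; rewrite /= /bad.
  by apply/hasP; exists x => //; apply/hasP; exists y.
rewrite has_predC negbK all_count sizeH => /eqP cH.
suff : count bad H <= M * (4 * l + 1) by nia.
apply: leq_trans (_ : \sum_(x <- X) \sum_(y <- Y)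
    count (fun h => color h x == color h y) H <= _).
  elim: H {sizeH cH} => [|h H' IH] //=.
  under eq_bigr => x _ do rewrite big_split /=.
  rewrite big_split /=; apply: leq_add => //.
  rewrite /bad; case: hasP => [[x xX /hasP[y yY c]]|] //=.
  by rewrite (big_rem x) //= (big_rem y) //= c.
apply: leq_trans (_ : \sum_(x <- X) \sum_(y <- Y) (4 * l + 1) <= _).
  rewrite big_seq [leqRHS]big_seq; apply: leq_sum => x xX.
  rewrite big_seq [leqRHS]big_seq; apply: leq_sum => y yY.
  apply: count_collisions (sX _ xX) (sY _ yY) _.
  by apply: contraNneq dis => xy; apply/hasP; exists y; rewrite //= -xy.
rewrite !big_const_seq !count_predT !iter_addn_0 -mulnA mulnC leq_mul2r.
by rewrite [size Y * _]mulnC le orbT.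
Qed.

End Separation.

Lemma mem_hash_family L h : h \in hash_family L -> exists H, h = new_hash H.
Proof.
by elim: L => //= L IH; rewrite inE => /orP[/eqP ->|/IH //]; eexists.
Qed.

Lemma size_hash_family L : size (hash_family L) = L.
Proof. by elim: L => //= L ->. Qed.

End GreedyHashing.

(** * The covering family *)

Section Tuples.
Variables (C : eqType) (colors : seq C).
Implicit Types (t cs : seq C) (ts : seq (seq C)).

Definition extend_tuples ts := [seq c :: t | t <- ts, c <- colors].

Definition tuples k := iter k extend_tuples [:: [::]].

Lemma size_tuples k : size (tuples k) = size colors ^ k.
Proof. by elim: k => //= k IH; rewrite size_allpairs IH expnSr. Qed.

Lemma mem_tuples k t : t \in tuples k -> size t = k.
Proof.
elim: k t => [|k IH] t; first by rewrite inE => /eqP ->.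
by case/allpairsP => -[s c] /= [/IH <- _ ->].
Qed.

Lemma tuples_complete k t : size t = k -> {subset t <= colors} ->
  t \in tuples k.
Proof.
elim: k t => [|k IH] [|c t] //= [sz] sub; apply/allpairsP; exists (t, c).
split=> //; last exact/sub/mem_head.
by apply: IH => // x xt; apply: sub; rewrite inE xt orbT.
Qed.

Lemma pad_to_tuple k cs : colors != [::] -> size cs <= k ->
  {subset cs <= colors} ->
  exists2 t, t \in tuples k &
    {subset cs <= t} /\ (cs != [::] -> {subset t <= cs}).
Proof.
case: (colors) (@tuples_complete k) => // d ds complete _ szc sub.
exists (cs ++ nseq (k - size cs) (head d cs)); last first.
  split=> [x xc|]; first by rewrite mem_cat xc.
  case: (cs) => // c s _ x; rewrite mem_cat => /orP[//|].
  by rewrite mem_nseq => /andP[_ /eqP ->]; rewrite mem_head.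
apply: complete; first by rewrite size_cat size_nseq subnKC.
move=> x; rewrite mem_cat mem_nseq => /orP[/sub //|/andP[_ /eqP ->]].
by case: (cs) sub => [_|c s]; [exact: mem_head | apply; exact: mem_head].
Qed.

End Tuples.

Lemma up_log_le_log2 n : up_log 2 n <= 2 * log2 n.
Proof.
case: n => [|[|n]]; rewrite ?up_log0 ?up_log1 // up_log_trunc_log //.
have : trunc_log 2 n.+1 <= trunc_log 2 n.+2 by rewrite leq_trunc_log.
by rewrite /log2 [n.+2.-1]/=; lia.
Qed.

Section Family.
Variables (G : digraph) (T : {set vertex G}) (k : nat).
Notation n := (nb_vertices G).
Implicit Types (h : seq (nat * nat)) (t D : seq nat) (v w : vertex G).

Definition palette := iota 0 (2 ^ (4 * k + 3)).

Definition hashes := hash_family palette (iota 0 n)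
  (2 ^ (4 * k + 2) * (2 * up_log 2 n + 1)).

Definition colored_in h t D := all (fun x => color h x \in t) D.

Definition colored_shadow h t : {set vertex G} :=
  [set v | (v \notin T) && has (colored_in h t) (separator_list T k v)].

Definition covering_family : seq {set vertex G} :=
  set0 :: [seq colored_shadow h t | h <- hashes, t <- tuples palette k].

Lemma covering_family_sub Z : Z \in covering_family -> Z \subset ~: T.
Proof.
rewrite inE => /orP[/eqP ->|/allpairsP[[h t] [_ _ ->]]]; first exact: sub0set.
by apply/subsetP => v; rewrite !inE => /andP[].
Qed.

Lemma size_covering_family :
  size covering_family <= 2 ^ (4 * k ^ 2 + 7 * k + 5) * log2 n.
Proof.
rewrite /= size_allpairs size_hash_family size_tuples size_iota -expnM.
rewrite mulnAC -expnD.
have -> : 4 * k + 2 + (4 * k + 3) * k = 4 * k ^ 2 + 7 * k + 2.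
  by rewrite -mulnn; lia.
rewrite -[5]/(2 + 3) addnA (expnD _ _ 3) -mulnA.
have : 0 < 2 ^ (4 * k ^ 2 + 7 * k + 2) by rewrite expn_gt0.
have : 1 <= log2 n by rewrite /log2; lia.
move: (2 ^ _) (log2 n) (up_log_le_log2 n) => x l.
by move: (up_log 2 n); clear=> u; nia.
Qed.

Section Cover.
Variable W : {set vertex G}.
Hypothesis targets_nonempty : T != set0.
Hypothesis subW : W \subset ~: (T :|: undeletable G).
Hypothesis thinW : thin T W.
Hypothesis cardW : #|W| <= k.

Let escape D := head 0 [seq x <- D | x \notin vals W].
Let escapes := [seq escape D | x <- vals W, D <- separator_list T k x].

Lemma thin_escape w D : w \in W -> D \in separator_list T k w ->
  [/\ escape D \in D, escape D \notin vals W & escape D < n].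
Proof.
move=> wW DL; have := subsetP subW _ wW; rewrite !inE => wTU.
have wT : w \notin T by apply: contra wTU => ->.
have [rD sepD] := separator_list_sound targets_nonempty wT DL.
suff : escape D \in [seq x <- D | x \notin vals W].
  by rewrite mem_filter => /andP[eW eD]; split=> //; apply: removable_lt rD eD.
rewrite /escape; case E: (filter _ _) => [|x s]; last exact: mem_head.
have := thinW wW; rewrite inE => /negP[]; apply: separator_mono sepD.
  apply/subsetP => u; rewrite !inE => uD; apply/andP; split.
    have [x + /val_inj ->] := rD u uD.
    by rewrite !inE !negb_or => /andP[/andP[]].
  apply: contraT => uW; have : (u : nat) \in [seq x <- D | x \notin vals W].
    by rewrite mem_filter mem_vals uW.
  by rewrite E.
apply/subsetP => u; rewrite !inE => /andP[uw /(subsetP subW)].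
by rewrite !inE (negPf uw).
Qed.

Lemma escapesP x : x \in escapes ->
  exists2 w : vertex G, w \in W
    & exists2 D, D \in separator_list T k w & x = escape D.
Proof.
case/flatten_mapP => _ /valsP[w wW ->] /mapP[D DL ->].
by exists w => //; exists D.
Qed.

Lemma mem_escapes w D : w \in W -> D \in separator_list T k w ->
  escape D \in escapes.
Proof.
by move=> wW DL; apply/flatten_mapP; exists (w : nat); rewrite ?mem_vals ?map_f.
Qed.

Lemma size_escapes : size (vals W) * size escapes <= 2 ^ (4 * k + 1).
Proof.
have szW : size (vals W) <= k by rewrite size_vals.
have szE : size escapes <= size (vals W) * 2 ^ (2 * k + 1).
  rewrite /escapes; elim: (vals W) => //= w s IH.
  by rewrite size_cat size_map mulSn leq_add ?size_separator_list.
apply: leq_trans (leq_mul szW (leq_trans szE (leq_mul szW (leqnn _)))) _.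
have lt : k <= 2 ^ k by apply/ltnW/ltn_expl.
rewrite (_ : 4 * k + 1 = k + (k + (2 * k + 1))); last by lia.
by rewrite !(expnD 2 k) !leq_mul.
Qed.

Lemma separating_coloring : exists2 h, h \in hashes &
  {in vals W & escapes, forall x y, color h x != color h y}.
Proof.
rewrite /hashes addnS expnS; apply: separating_hash size_escapes.
- exact: iota_uniq.
- exact: iota_uniq.
- by rewrite expn_gt0.
- by rewrite size_iota -(expnD 2 2) leq_exp2l //; lia.
- by rewrite size_iota; apply: up_logP.
- by move=> _ /valsP[u _ ->]; rewrite mem_iota /= ltn_ord.
- move=> x /escapesP[w wW [D DL ->]]; rewrite mem_iota.
  by case: (thin_escape wW DL).
- by apply/hasPn => x /escapesP[w wW [D DL ->]]; case: (thin_escape wW DL).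
Qed.

Lemma covering_shadow : exists2 Z, Z \in covering_family & W :&: Z = set0 /\
  forall v (S : {set vertex G}), S \subset W ->
    important_separator [set v] T S -> v \in Z.
Proof.
have [h hH sep] := separating_coloring.
pose cs := [seq color h x | x <- vals W].
have mem_cs w : w \in W -> color h w \in cs.
  by move=> wW; apply: map_f; rewrite mem_vals.
have sub_cs : {subset cs <= palette}.
  move=> _ /mapP[x _ ->]; have [H ->] := mem_hash_family hH.
  have := color_new_hash palette (iota 0 n) H x.
  rewrite inE => /orP[/eqP ->|//].
  by rewrite mem_iota expn_gt0.
have [||//|t tT [sub_t t_sub]] := @pad_to_tuple _ palette k cs.
- by rewrite -size_eq0 size_iota expn_eq0.
- by rewrite size_map size_vals.
exists (colored_shadow h t).
  by rewrite inE; apply/orP; right; apply/allpairsP; exists (h, t).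
split=> [|v S SW impS].
  apply/setP => w; rewrite !inE; apply/and3P => -[wW _ /hasP[D DL /allP colD]].
  have [eD eW _] := thin_escape wW DL.
  have /t_sub/(_ _ (colD _ eD))/mapP[x xW ex] : cs != [::].
    by apply: contraTneq (mem_cs w wW) => ->.
  by have := sep _ _ xW (mem_escapes wW DL); rewrite ex eqxx.
have vT := important_source_notin_targets impS.
have [D DL vsetD] := separator_list_complete impS
  (leq_trans (subset_leq_card SW) cardW).
have [rD _] := separator_list_sound targets_nonempty vT DL.
rewrite inE vT; apply/hasP; exists D => //; apply/allP => x xD.
have [u _ xu] := rD x xD; apply: sub_t; rewrite xu; apply/mem_cs/(subsetP SW).
by rewrite -vsetD inE -xu.
Qed.

End Cover.

Lemma covering_familyP (W Y : {set vertex G}) :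
  W \subset ~: (T :|: undeletable G) -> thin T W -> #|W| <= k ->
  (forall v, v \in Y -> exists S : {set vertex G},
     S \subset W /\ important_separator [set v] T S) ->
  exists2 Z, Z \in covering_family & W :&: Z = set0 /\ Y \subset Z.
Proof.
move=> subW thinW cardW impY; have [T0|T0] := eqVneq T set0.
  exists set0; first exact: mem_head.
  split; first exact: setI0.
  apply/subsetP => v /impY[S [_ /important_targets]].
  by rewrite T0 eqxx.
have [Z ZF [WZ memZ]] := covering_shadow T0 subW thinW cardW.
exists Z => //; split=> //; apply/subsetP => v /impY[S [SW impS]].
exact: memZ impS.
Qed.

(** ** The family as lists of numbers *)

Definition separator_lists : seq (nat * seq (seq nat)) :=
  [seq (x, separator_list T k x) | x <- iota 0 n & x \notin vals T].

Definition shadow_list (L : seq (nat * seq (seq nat))) h t : seq nat :=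
  [seq vD.1 | vD <- L & has (colored_in h t) vD.2].

Lemma filter_iota_vals (p : pred nat) :
  [seq x <- iota 0 n | p x] = vals [set v : vertex G | p v].
Proof.
rewrite -(val_enum_ord n) filter_map /vals; congr map.
rewrite /enum_mem -filter_predI; apply: eq_filter => u.
by rewrite /= [RHS](in_set (fun u : vertex G => p u)) andbT.
Qed.

Lemma shadow_listE h t : shadow_list separator_lists h t =
  vals (colored_shadow h t).
Proof.
rewrite /shadow_list /separator_lists filter_map -map_comp map_id -filter_predI.
rewrite (filter_iota_vals (fun x => has (colored_in h t) (separator_list T k x)
  && (x \notin vals T))).
by congr vals; apply/setP => v; rewrite !inE mem_vals andbC.
Qed.

Lemma covering_familyE : [seq vals Z | Z <- covering_family] =
  [::] :: [seq shadow_list separator_lists h t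
          | h <- hashes, t <- tuples palette k].
Proof.
rewrite /covering_family map_cons map_allpairs {1}/vals enum_set0; congr cons.
by apply: eq_allpairs => // h t; rewrite shadow_listE.
Qed.

End Family.

(** * A typed surface language *)

HB.mixin Record isEncodable T := { encode : T -> data }.

#[short(type="encType")]
HB.structure Definition Encodable := { T of isEncodable T & Equality T }.

Definition encode_bool (b : bool) := VNat b.
HB.instance Definition _ := isEncodable.Build nat (fun n : nat => VNat n).
HB.instance Definition _ := isEncodable.Build bool encode_bool.

Section ProductEncoding.
Variables A B : encType.
HB.instance Definition _ :=
  isEncodable.Build (A * B)%type (fun p => VPair (encode p.1) (encode p.2)).
End ProductEncoding.

Section SeqEncoding.
Variable A : encType.
HB.instance Definition _ :=
  isEncodable.Build (seq A) (fun s => enc_seq [seq encode x | x <- s]).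
End SeqEncoding.

Section OptionEncoding.
Variable A : encType.
Definition encode_option (o : option A) :=
  if o is Some x then VPair (encode x) (VNat 0) else VNat 0.
HB.instance Definition _ := isEncodable.Build (option A) encode_option.
End OptionEncoding.

(* A term is given at every binding depth: naming a bound variable by its
   level makes the name valid under further binders, so that the binders of
   the language can be those of Rocq. *)
Record code (T : encType) := Code { compile : nat -> expr }.

Record func (A B : encType) := Func { fn_index : nat }.

Arguments code T%_type.
Arguments func (A B)%_type.

Declare Scope code_scope.
Delimit Scope code_scope with code.
Bind Scope code_scope with code.

Section Terms.
Implicit Types A B C : encType.

Definition CVar {A} l : code A := Code A (fun d => EVar (d - l.+1)).
Definition CNum n : code nat := Code _ (fun=> EConst n).
Definition CAdd (a b : code nat) : code nat :=
  Code _ (fun d => EAdd (compile a d) (compile b d)).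
Definition CSub (a b : code nat) : code nat :=
  Code _ (fun d => ESub (compile a d) (compile b d)).
Definition CPair {A B} (a : code A) (b : code B) : code (A * B) :=
  Code _ (fun d => EMkPair (compile a d) (compile b d)).
Definition CFst {A B} (p : code (A * B)) : code A :=
  Code _ (fun d => EFst (compile p d)).
Definition CSnd {A B} (p : code (A * B)) : code B :=
  Code _ (fun d => ESnd (compile p d)).
Definition CNil {A} : code (seq A) := Code _ (fun=> EConst 0).
Definition CCons {A} (x : code A) (s : code (seq A)) : code (seq A) :=
  Code _ (fun d => EMkPair (compile x d) (compile s d)).
Definition CNone {A} : code (option A) := Code _ (fun=> EConst 0).
Definition CSome {A} (x : code A) : code (option A) :=
  Code _ (fun d => EMkPair (compile x d) (EConst 0)).
Definition CLet {A B} (a : code A) (b : code A -> code B) : code B :=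
  Code _ (fun d => ELet (compile a d) (compile (b (CVar d)) d.+1)).
Definition CIf {A} (c : code bool) (a b : code A) : code A :=
  Code _ (fun d => EIf (compile c d) (compile a d) (compile b d)).
Definition CTrue : code bool := Code _ (fun=> EConst 1).
Definition CFalse : code bool := Code _ (fun=> EConst 0).
Definition CLt (a b : code nat) : code bool :=
  Code _ (fun d =>
    EIf (ESub (compile b d) (compile a d)) (EConst 1) (EConst 0)).
Definition CEq (a b : code nat) : code bool :=
  CIf (CLt a b) CFalse (CIf (CLt b a) CFalse CTrue).
Definition CCall {A B} (f : func A B) (a : code A) : code B :=
  Code _ (fun d => ECall (fn_index f) (compile a d)).
Definition CIfCons {A B} (s : code (seq A))
    (a : code A -> code (seq A) -> code B) (b : code B) : code B :=
  Code _ (fun d => ELet (compile s d) (EIf (EIsPair (EVar 0))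
    (ELet (EFst (EVar 0)) (ELet (ESnd (EVar 1))
      (compile (a (CVar d.+1) (CVar d.+2)) d.+3)))
    (compile b d.+1))).
Definition CIfSome {A B} (o : code (option A))
    (a : code A -> code B) (b : code B) : code B :=
  Code _ (fun d => ELet (compile o d) (EIf (EIsPair (EVar 0))
    (ELet (EFst (EVar 0)) (compile (a (CVar d.+1)) d.+2)) (compile b d.+1))).

Definition CFun {A B} (b : code A -> code B) : expr := compile (b (CVar 0)) 1.

End Terms.

Notation "a + b" := (CAdd a b) : code_scope.
Notation "a - b" := (CSub a b) : code_scope.
Notation "a < b" := (CLt a b) : code_scope.
Notation "a == b" := (CEq a b) : code_scope.
Notation "( a , b , .. , c )" := (CPair .. (CPair a b) .. c) : code_scope.
Notation "p .1" := (CFst p) : code_scope.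
Notation "p .2" := (CSnd p) : code_scope.
Notation "[ :: ]" := CNil : code_scope.
Notation "x :: s" := (CCons x s) : code_scope.
Notation "'let!' x := a 'in' b" := (CLet a (fun x => b))
  (at level 200, x name, a at level 100, b at level 200) : code_scope.

Definition within (Q : nat -> Prop) c := exists2 t, t <= c & Q t.

Lemma within_weaken Q c c' : within Q c -> c <= c' -> within Q c'.
Proof. by case=> t le Qt le'; exists t => //; apply: leq_trans le'. Qed.

Lemma withinS (Q R : nat -> Prop) c :
  (forall t, Q t -> R t.+1) -> within Q c -> within R c.+1.
Proof. by move=> QR [t le /QR Rt]; exists t.+1. Qed.

Lemma withinD (Q1 Q2 R : nat -> Prop) c1 c2 :
  (forall t1 t2, Q1 t1 -> Q2 t2 -> R (t1 + t2).+1) ->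
  within Q1 c1 -> within Q2 c2 -> within R (c1 + c2).+1.
Proof.
move=> QR [t1 le1 Q1t] [t2 le2 Q2t]; exists (t1 + t2).+1; last exact: QR.
by rewrite ltnS leq_add.
Qed.

Section Evaluation.
Variable P : program.
Implicit Types (A B C : encType) (env : seq data).

Definition ev A env (e : code A) (x : A) :=
  within (eval P env (compile e (size env)) (encode x)).

Definition call A B (f : func A B) (x : A) (y : B) :=
  within (eval P [:: encode x] (nth (EConst 0) P (fn_index f)) (encode y)).

Lemma call_fun A B (f : func A B) (b : code A -> code B) x y c :
  nth (EConst 0) P (fn_index f) = CFun b -> ev [:: encode x] (b (CVar 0)) y c ->
  call f x y c.
Proof. by rewrite /call => ->. Qed.

Lemma call_weaken A B (f : func A B) x y c c' :
  call f x y c -> c <= c' -> call f x y c'.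
Proof. exact: within_weaken. Qed.

Lemma ev_weaken A env (e : code A) x c c' :
  ev env e x c -> c <= c' -> ev env e x c'.
Proof. exact: within_weaken. Qed.

Lemma ev_conv A env (e : code A) x y c c' :
  ev env e x c -> x = y -> c <= c' -> ev env e y c'.
Proof. by move=> Ee <-; apply: ev_weaken. Qed.

Lemma ev_var A env l (x : A) :
  nth (VNat 0) env (size env - l.+1) = encode x -> ev env (CVar l) x 1.
Proof. by move=> E; exists 1; rewrite -?E //; constructor. Qed.

Lemma ev_num env n : ev env (CNum n) n 1.
Proof. by exists 1 => //; constructor. Qed.

Lemma ev_add env a b x y c1 c2 :
  ev env a x c1 -> ev env b y c2 -> ev env (CAdd a b) (x + y) (c1 + c2).+1.
Proof. by apply: withinD => t1 t2; apply: EvAdd. Qed.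

Lemma ev_sub env a b x y c1 c2 :
  ev env a x c1 -> ev env b y c2 -> ev env (CSub a b) (x - y) (c1 + c2).+1.
Proof. by apply: withinD => t1 t2; apply: EvSub. Qed.

Lemma ev_pair A B env a b (x : A) (y : B) c1 c2 :
  ev env a x c1 -> ev env b y c2 -> ev env (CPair a b) (x, y) (c1 + c2).+1.
Proof. by apply: withinD => t1 t2; apply: EvMkPair. Qed.

Lemma ev_fst A B env p (x : A * B) c :
  ev env p x c -> ev env (CFst p) x.1 c.+1.
Proof. by apply: withinS => t; apply: EvFst. Qed.

Lemma ev_snd A B env p (x : A * B) c :
  ev env p x c -> ev env (CSnd p) x.2 c.+1.
Proof. by apply: withinS => t; apply: EvSnd. Qed.

Lemma ev_nil A env : ev env CNil ([::] : seq A) 1.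
Proof. by exists 1 => //; constructor. Qed.

Lemma ev_cons A env a b (x : A) s c1 c2 :
  ev env a x c1 -> ev env b s c2 -> ev env (CCons a b) (x :: s) (c1 + c2).+1.
Proof. by apply: withinD => t1 t2; apply: EvMkPair. Qed.

Lemma ev_none A env : ev env CNone (None : option A) 1.
Proof. by exists 1 => //; constructor. Qed.

Lemma ev_some A env a (x : A) c : ev env a x c ->
  ev env (CSome a) (Some x) c.+2.
Proof.
move=> Ea; rewrite -addn1; apply: withinD Ea (ev_num env 0) => t1 t2.
exact: EvMkPair.
Qed.

Lemma ev_let A B env a b (x : A) (y : B) c1 c2 :
  ev env a x c1 -> ev (encode x :: env) (b (CVar (size env))) y c2 ->
  ev env (CLet a b) y (c1 + c2).+1.
Proof. by apply: withinD => t1 t2; apply: EvLet. Qed.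

Lemma ev_call A B env (f : func A B) a x y c1 c2 :
  ev env a x c1 -> call f x y c2 -> ev env (CCall f a) y (c1 + c2).+1.
Proof. by apply: withinD => t1 t2; apply: EvCall. Qed.

Lemma ev_true env : ev env CTrue true 1.
Proof. by exists 1 => //; constructor. Qed.

Lemma ev_false env : ev env CFalse false 1.
Proof. by exists 1 => //; constructor. Qed.

Lemma ev_if_cond A env e a b (p : bool) (x : A) c c1 c2 : ev env e p c ->
  (p -> ev env a x c1) -> (~~ p -> ev env b x c2) ->
  ev env (CIf e a b) x (c + c1 + c2).+1.
Proof.
move=> Ee Ea Eb; rewrite -addnA.
have [Ep|np] := boolP p; [move: (Ea Ep) | move: (Eb np)] => Ex.
  apply: withinD Ee (within_weaken Ex (leq_addr c2 c1)) => t1 t2.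
  by rewrite Ep => Ee; apply: EvIf Ee.
apply: withinD Ee (within_weaken Ex (leq_addl c1 c2)) => t1 t2.
by rewrite (negPf np) => Ee; apply: EvIf Ee.
Qed.

Lemma ev_if A env e a b (p : bool) (x y : A) c c1 c2 :
  ev env e p c -> ev env a x c1 -> ev env b y c2 ->
  ev env (CIf e a b) (if p then x else y) (c + c1 + c2).+1.
Proof. by move=> Ep Ea Eb; apply: (ev_if_cond Ep); case: p {Ep}. Qed.

Lemma ev_lt env a b x y c1 c2 :
  ev env a x c1 -> ev env b y c2 -> ev env (CLt a b) (x < y) (c2 + c1).+3.
Proof.
move=> Ea Eb; rewrite -(addn1 (c2 + c1).+1).
apply: withinD (ev_sub Eb Ea) (ev_num env (x < y)) => t1 t2 Et1 Et2.
apply: EvIf Et1 _; rewrite subn_eq0 leqNgt; move: Et2.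
by case: (x < y).
Qed.

Lemma ev_eq env a b x y c1 c2 :
  ev env a x c1 -> ev env b y c2 ->
  ev env (CEq a b) (x == y) (2 * (c1 + c2) + 12).
Proof.
move=> Ea Eb.
have := ev_if (ev_lt Ea Eb) (ev_false env)
          (ev_if (ev_lt Eb Ea) (ev_false env) (ev_true env)).
have -> : (if x < y then false else if y < x then false else true) = (x == y).
  by case: ltngtP.
by move/ev_weaken; apply; lia.
Qed.

Lemma ev_if_cons A B env e a b (s : seq A) (y : B) c c1 c2 : ev env e s c ->
  (forall x t, s = x :: t ->
     ev [:: encode t, encode x, encode s & env]
        (a (CVar (size env).+1) (CVar (size env).+2)) y c1) ->
  (s = [::] -> ev (encode s :: env) b y c2) ->
  ev env (CIfCons e a b) y (c + c1 + c2 + 10).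
Proof.
move=> [t l E]; case: s E => [|x s] E Ha Hb.
  have [t2 l2 E2] := Hb erefl; exists (t + (2 + t2).+1).+1; first by lia.
  apply: EvLet E _; apply: (EvIf (n := 0)); last exact: E2.
  by apply: (@EvIsPair _ _ _ (VNat 0)); apply: (EvVar _ _ 0).
have [t1 l1 E1] := Ha x s erefl.
exists (t + (2 + (2 + (2 + t1).+1).+1).+1).+1; first by lia.
apply: EvLet E _; apply: (EvIf (n := 1)).
  by apply: (@EvIsPair _ _ _ (encode (x :: s))); apply: (EvVar _ _ 0).
apply: EvLet; first by apply: EvFst; apply: (EvVar _ _ 0).
apply: EvLet; first by apply: EvSnd; apply: (EvVar _ _ 1).
exact: E1.
Qed.

Lemma ev_if_some A B env e a b (o : option A) (y : B) c c1 c2 : ev env e o c ->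
  (forall x, o = Some x ->
     ev [:: encode x, encode o & env] (a (CVar (size env).+1)) y c1) ->
  (o = None -> ev (encode o :: env) b y c2) ->
  ev env (CIfSome e a b) y (c + c1 + c2 + 7).
Proof.
move=> [t l E]; case: o E => [x|] E Ha Hb.
  have [t1 l1 E1] := Ha x erefl.
  exists (t + (2 + (2 + t1).+1).+1).+1; first by lia.
  apply: EvLet E _; apply: (EvIf (n := 1)).
    by apply: (@EvIsPair _ _ _ (encode (Some x))); apply: (EvVar _ _ 0).
  by apply: EvLet; first by apply: EvFst; apply: (EvVar _ _ 0).
have [t2 l2 E2] := Hb erefl; exists (t + (2 + t2).+1).+1; first by lia.
apply: EvLet E _; apply: (EvIf (n := 0)); last exact: E2.
by apply: (@EvIsPair _ _ _ (VNat 0)); apply: (EvVar _ _ 0).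
Qed.

End Evaluation.

(* Evaluates a term to the Rocq expression that it denotes, leaving the calls
   as subgoals. *)
Ltac evs :=
  lazymatch goal with
  | |- ev _ _ ?e0 _ _ =>
    let e := eval cbv beta zeta in e0 in
    lazymatch e with
    | CNum _ => apply: ev_num
    | CVar _ => eapply ev_var; cbv [nth size subn Nat.sub]; reflexivity
    | CAdd _ _ => eapply ev_add; [evs | evs]
    | CSub _ _ => eapply ev_sub; [evs | evs]
    | CPair _ _ => eapply ev_pair; [evs | evs]
    | CFst _ => eapply ev_fst; evs
    | CSnd _ => eapply ev_snd; evs
    | CNil => apply: ev_nil
    | CCons _ _ => eapply ev_cons; [evs | evs]
    | CNone => apply: ev_none
    | CSome _ => eapply ev_some; evs
    | CTrue => apply: ev_true
    | CFalse => apply: ev_false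
    | CLt _ _ => eapply ev_lt; [evs | evs]
    | CEq _ _ => eapply ev_eq; [evs | evs]
    | CIf _ _ _ => eapply ev_if; [evs | evs | evs]
    | CLet _ _ => eapply ev_let; [evs | evs]
    | CCall _ _ => eapply ev_call; [evs | ]
    | _ => idtac
    end
  | _ => idtac
  end.

Section ListRecursion.
Variables (P : program) (A B C : encType) (f : func (C * seq A) B).

Definition listrec (base : code C -> code B)
    (step : code C -> code A -> code (seq A) -> code B -> code B) : expr :=
  CFun (fun input => CLet (CFst input) (fun ctx =>
    CIfCons (CSnd input)
      (fun x s => CLet (CCall f (CPair ctx s)) (fun r => step ctx x s r))
        (base ctx))).

Lemma call_listrec base step (F : seq A -> B) ctx s p c :
  nth (EConst 0) P (fn_index f) = listrec base step ->
  size s <= p -> 0 < p -> 0 < c ->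
  ev P [:: encode ([::] : seq A); encode ctx; encode (ctx, [::] : seq A)]
    (base (CVar 1)) (F [::]) (10 * c) ->
  (forall x t, suffix (x :: t) s ->
     ev P [:: encode (F t); encode t; encode x; encode (x :: t); encode ctx;
              encode (ctx, x :: t)]
       (step (CVar 1) (CVar 3) (CVar 4) (CVar 5)) (F (x :: t)) (50 * c)) ->
  call P f (ctx, s) (F s) (100 * p * c).
Proof.
move=> Pf le p0 c0 Hbase Hstep.
apply: (call_weaken (c := size s * (50 * c + 20) + (10 * c + 20))); last by nia.
elim: s {le} Hstep => [|x s IH] Hstep; apply: call_fun Pf _; apply: ev_weaken.
- evs; eapply (ev_if_cons (c1 := 0)); [evs|by []|].
  by move=> _; exact: Hbase.
- by rewrite /=; lia.
- evs; eapply (ev_if_cons (c2 := 0)); [evs| |by []].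
  move=> x' t [<- <-]; evs; last exact: Hstep (suffix_refl _).
  apply: IH => y t' suf; apply: Hstep.
  exact: suffix_trans suf (suffix_cons _ _).
- by rewrite /=; lia.
Qed.

End ListRecursion.

Section NatRecursion.
Variables (P : program) (B C : encType) (f : func (C * nat) B).

Definition natrec (base : code C -> code B)
    (step : code C -> code nat -> code B -> code B) : expr :=
  CFun (fun input => CLet (CFst input) (fun ctx => CLet (CSnd input) (fun n =>
    CIf (CLt (CNum 0) n)
      (CLet (CSub n (CNum 1)) (fun j =>
        CLet (CCall f (CPair ctx j)) (fun r => step ctx j r)))
      (base ctx)))).

Lemma call_natrec base step (F : nat -> B) ctx n p c :
  nth (EConst 0) P (fn_index f) = natrec base step ->
  n <= p -> 0 < p -> 0 < c ->
  ev P [:: encode 0; encode ctx; encode (ctx, 0)] (base (CVar 1)) (F 0)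
    (10 * c) ->
  (forall j, j < n ->
     ev P [:: encode (F j); encode j; encode j.+1; encode ctx;
              encode (ctx, j.+1)]
       (step (CVar 1) (CVar 3) (CVar 4)) (F j.+1) (50 * c)) ->
  call P f (ctx, n) (F n) (100 * p * c).
Proof.
move=> Pf le p0 c0 Hbase Hstep.
apply: (call_weaken (c := n * (50 * c + 25) + (10 * c + 15))); last by nia.
elim: n {le} Hstep => [|n IH] Hstep; apply: call_fun Pf _; apply: ev_weaken.
- do 2!(eapply ev_let; first by evs).
  by eapply (ev_if_cond (c1 := 0)); [evs | | move=> _; exact: Hbase].
- by rewrite /=; lia.
- do 2!(eapply ev_let; first by evs).
  eapply (ev_if_cond (c2 := 0)); [evs | move=> _ | by []].
  eapply ev_let; first by eapply ev_conv; [evs | exact: subn1 | exact: leqnn].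
  evs; last exact: Hstep.
  by apply: IH => j lt; apply/Hstep/ltnW.
- by rewrite /=; lia.
Qed.

End NatRecursion.

(** * The program *)

Notation hash := (seq (nat * nat)).

Definition main_fn :
  func (nat * (seq (seq nat) * (seq nat * (seq nat * nat)))) (seq (seq nat)) :=
    Func _ _ 0.
Definition iota_fn : func (nat * nat) (seq nat) := Func _ _ 1.
Definition shift_fn : func (nat * nat) nat := Func _ _ 2.
Definition mul_fn : func (nat * nat) nat := Func _ _ 3.
Definition up_log_fn : func (nat * nat) nat := Func _ _ 4.
Definition ncons_fn {A : encType} :
  func ((A * seq A) * nat) (seq A) := Func _ _ 5.
Definition mem_fn : func (nat * seq nat) bool := Func _ _ 6.
Definition assoc_fn {A : encType} : func (nat * seq (nat * A)) (option A) :=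
  Func _ _ 7.
Definition round_fn : func (table nat * arcs nat) (table nat) := Func _ _ 8.
Definition init_table_fn : func (nat * seq nat) (table nat) := Func _ _ 9.
Definition bfs_fn : func ((seq nat * arcs nat) * arcs nat) (table nat) :=
  Func _ _ 10.
Definition source_path_fn : func (table nat * seq nat) (option (arcs nat)) :=
  Func _ _ 11.
Definition rem_fn : func ((nat * nat) * arcs nat) (arcs nat) := Func _ _ 12.
Definition augment_fn : func (arcs nat * arcs nat) (arcs nat) := Func _ _ 13.
Definition flow_fn :
  func ((seq nat * seq nat) * (arcs nat * nat)) (option (table nat)) :=
    Func _ _ 14.
Definition crossing_arc_fn : func (table nat * arcs nat) (option (nat * nat)) :=
  Func _ _ 15.
Definition delete_tails_fn : func (seq nat * arcs nat) (arcs nat) :=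
  Func _ _ 16.
Definition cat_fn {A : encType} : func (seq A * seq A) (seq A) := Func _ _ 17.
Definition separator_tree_fn :
  func ((arcs nat * (seq nat * nat)) * (nat * (seq nat * seq nat)))
    (seq (seq nat)) := Func _ _ 18.
Definition separator_lists_fn :
  func (((arcs nat * (seq nat * nat)) * nat) * seq nat)
    (seq (nat * seq (seq nat))) := Func _ _ 19.
Definition drop_fn {A : encType} : func (seq A * nat) (seq A) := Func _ _ 20.
Definition exit_arcs_fn :
  func (((nat * nat) * arcs nat) * seq nat) (arcs nat) := Func _ _ 21.
Definition split_network_fn :
  func ((seq (seq nat) * (seq nat * (nat * nat))) * seq nat) (arcs nat) :=
    Func _ _ 22.
Definition color_fn : func (nat * hash) nat := Func _ _ 23.
Definition weight_fn : func ((nat * nat) * seq hash) nat := Func _ _ 24.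
Definition cost_fn : func ((nat * (nat * seq hash)) * hash) nat := Func _ _ 25.
Definition cheapest_fn : func ((nat * (hash * seq hash)) * seq nat) nat :=
  Func _ _ 26.
Definition new_hash_fn : func ((seq nat * seq hash) * seq nat) hash :=
  Func _ _ 27.
Definition hash_family_fn : func ((seq nat * seq nat) * nat) (seq hash) :=
  Func _ _ 28.
Definition cons_all_fn :
  func ((seq nat * seq (seq nat)) * seq nat) (seq (seq nat)) := Func _ _ 29.
Definition extend_tuples_fn : func (seq nat * seq (seq nat)) (seq (seq nat)) :=
  Func _ _ 30.
Definition tuples_fn : func (seq nat * nat) (seq (seq nat)) := Func _ _ 31.
Definition colored_in_fn : func ((hash * seq nat) * seq nat) bool :=
  Func _ _ 32.
Definition has_colored_fn : func ((hash * seq nat) * seq (seq nat)) bool :=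
  Func _ _ 33.
Definition shadow_list_fn :
  func ((hash * seq nat) * seq (nat * seq (seq nat))) (seq nat) := Func _ _ 34.
Definition shadows_fn :
  func (((seq (nat * seq (seq nat)) * hash) * seq (seq nat)) * seq (seq nat))
    (seq (seq nat)) := Func _ _ 35.
Definition family_fn :
  func ((seq (nat * seq (seq nat)) * seq (seq nat)) * seq hash)
    (seq (seq nat)) := Func _ _ 36.
Definition row_fn : func (seq (seq nat) * nat) (seq nat) := Func _ _ 37.

Local Open Scope code_scope.

Definition iota_body := CFun (fun input : code (nat * nat) =>
  let s := input.1 in let j := input.2 in
  CIf (CNum 0 < j) (s :: CCall iota_fn (s + CNum 1, j - CNum 1)) [::]).

Definition shift_body := natrec shift_fn id (fun _ _ r => r + r).

Definition mul_body := natrec mul_fn (fun=> CNum 0) (fun x _ r => x + r).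

(* The context is 1, so that shifting it by [r] yields [2 ^ r]. *)
Definition up_log_body := natrec up_log_fn (fun=> CNum 0)
  (fun one j r => CIf (CCall shift_fn (one, r) < j + one) (r + one) r).

Definition ncons_body A := natrec (@ncons_fn A) (fun c => c.2)
  (fun c _ r => c.1 :: r).

Definition mem_body := listrec mem_fn (fun=> CFalse)
  (fun x y _ r => CIf (x == y) CTrue r).

Definition assoc_body A := listrec (@assoc_fn A) (fun=> CNone)
  (fun x e _ r => CIf (e.1 == x) (CSome e.2) r).

Definition round_body := listrec round_fn id (fun _ a _ B =>
  CIfSome (CCall assoc_fn (a.1, B)) (fun=> B)
    (CIfSome (CCall assoc_fn (a.2, B)) (fun p => (a.1, a :: p) :: B) B)).

Definition init_table_body := listrec init_table_fn (fun=> [::])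
  (fun _ t _ r => (t, [::]) :: r).

Definition bfs_body := listrec bfs_fn
  (fun c => CCall init_table_fn (CNum 0, c.1))
  (fun c _ _ B => CCall round_fn (B, c.2)).

Definition source_path_body := listrec source_path_fn (fun=> CNone)
  (fun B x _ r => CIfSome (CCall assoc_fn (x, B)) (fun p => CSome p) r).

Definition rem_body := listrec rem_fn (fun=> [::])
  (fun a b s r => CIf (CIf (b.1 == a.1) (b.2 == a.2) CFalse) s (b :: r)).

Definition augment_body := listrec augment_fn id
  (fun _ a _ A => (a.2, a.1) :: CCall rem_fn (a, A)).

Definition flow_body :=
  CFun (fun input : code ((seq nat * seq nat) * (arcs nat * nat)) =>
    let Ts := input.1.1 in let Src := input.1.2 in
    let A := input.2.1 in let j := input.2.2 in
    let! B := CCall bfs_fn (Ts, A, A) in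
    CIfSome (CCall source_path_fn (B, Src))
      (fun p => CIf (CNum 0 < j)
        (CCall flow_fn (Ts, Src, (CCall augment_fn (A, p), j - CNum 1))) CNone)
      (CSome B)).

Definition crossing_arc_body := listrec crossing_arc_fn (fun=> CNone)
  (fun B a _ r =>
    CIfSome (CCall assoc_fn (a.1, B)) (fun=> r)
      (CIfSome (CCall assoc_fn (a.2, B)) (fun=> CSome a) r)).

Definition delete_tails_body := listrec delete_tails_fn (fun=> [::])
  (fun D a _ r => CIf (CCall mem_fn (a.1, D)) r (a :: r)).

Definition cat_body A := listrec (@cat_fn A) id (fun _ x _ r => x :: r).

Definition separator_tree_body :=
  CFun (fun input :
      code ((arcs nat * (seq nat * nat)) * (nat * (seq nat * seq nat))) =>
    let params := input.1 in
    let A := params.1 in let Ts := params.2.1 in let k := params.2.2 in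
    let j := input.2.1 in let D := input.2.2.1 in let Src := input.2.2.2 in
    let branch D Src :=
      CCall separator_tree_fn (params, (j - CNum 1, (D, Src))) in
    CIf (CNum 0 < j)
      (let! A' := CCall delete_tails_fn (D, A) in
       CIfSome (CCall flow_fn (Ts, Src, (A', k)))
         (fun B => CIfSome (CCall crossing_arc_fn (B, A'))
           (fun a => CCall cat_fn (branch D (a.2 :: Src),
             branch (a.1 :: D) Src))
           (D :: [::]))
         [::])
      [::]).

Definition separator_lists_body := listrec separator_lists_fn (fun=> [::])
  (fun c x _ r =>
    let params := c.1 in let Ts := params.2.1 in let k := params.2.2 in
    CIf (CCall mem_fn (x, Ts)) r
      ((x, CCall separator_tree_fn
             (params, (k + k + CNum 1, ([::], x :: c.2 + x :: [::])))) :: r)).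

Definition drop_body A := natrec (@drop_fn A) id
  (fun _ _ r => CIfCons r (fun _ s => s) [::]).

Definition row_body := CFun (fun input : code (seq (seq nat) * nat) =>
  CIfCons (CCall drop_fn (input.1, input.2)) (fun row _ => row) [::]).

Definition exit_arcs_body := listrec exit_arcs_fn (fun c => c.2)
  (fun c w _ r => CCall ncons_fn (c.1.1, w, r, c.1.2)).

Definition split_network_body := listrec split_network_fn (fun=> [::])
  (fun c u _ r =>
    let adj := c.1 in let U := c.2.1 in
    let n := c.2.2.1 in let copies := c.2.2.2 in
    CCall ncons_fn
      ((u, n + u),
       CCall exit_arcs_fn (n + u, copies, r, CCall row_fn (adj, u)),
       CIf (CCall mem_fn (u, U)) copies (CNum 1))).

Definition color_body := CFun (fun input : code (nat * hash) =>
  CIfSome (CCall assoc_fn (input.1, input.2)) id (CNum 0)).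

Definition weight_body := listrec weight_fn (fun=> CNum 1)
  (fun xy h _ r =>
    CIf (CCall color_fn (xy.1, h) == CCall color_fn (xy.2, h)) (r + r) r).

Definition cost_body := listrec cost_fn (fun=> CNum 0)
  (fun c e _ r =>
    let x := c.1 in let color := c.2.1 in let H := c.2.2 in
    CIf (e.2 == color) (CCall weight_fn (x, e.1, H) + r) r).

Definition cheapest_body := listrec cheapest_fn (fun=> CNum 0)
  (fun c d _ r =>
    let x := c.1 in let h := c.2.1 in let H := c.2.2 in
    let cost color := CCall cost_fn ((x, (color, H)), h) in
    CIf (cost d < cost r) d r).

Definition new_hash_body := listrec new_hash_fn (fun=> [::])
  (fun c x _ h => (x, CCall cheapest_fn ((x, (h, c.2)), c.1)) :: h).

Definition hash_family_body := natrec hash_family_fn (fun=> [::])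
  (fun c _ H => CCall new_hash_fn (c.1, H, c.2) :: H).

Definition cons_all_body := listrec cons_all_fn (fun c => c.2)
  (fun c x _ r => (x :: c.1) :: r).

Definition extend_tuples_body := listrec extend_tuples_fn (fun=> [::])
  (fun colors t _ r => CCall cons_all_fn (t, r, colors)).

Definition tuples_body := natrec tuples_fn (fun=> [::] :: [::])
  (fun colors _ ts => CCall extend_tuples_fn (colors, ts)).

Definition colored_in_body := listrec colored_in_fn (fun=> CTrue)
  (fun ht x _ r => CIf (CCall mem_fn (CCall color_fn (x, ht.1), ht.2)) r
    CFalse).

Definition has_colored_body := listrec has_colored_fn (fun=> CFalse)
  (fun ht D _ r => CIf (CCall colored_in_fn (ht, D)) CTrue r).

Definition shadow_list_body := listrec shadow_list_fn (fun=> [::])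
  (fun ht vD _ r => CIf (CCall has_colored_fn (ht, vD.2)) (vD.1 :: r) r).

Definition shadows_body := listrec shadows_fn (fun c => c.2)
  (fun c t _ r =>
    let L := c.1.1 in let h := c.1.2 in CCall shadow_list_fn (h, t, L) :: r).

Definition family_body := listrec family_fn (fun=> [::])
  (fun c h _ r => CCall shadows_fn (c.1, h, r, c.2)).

Definition main_body :=
  CFun (fun input :
      code (nat * (seq (seq nat) * (seq nat * (seq nat * nat)))) =>
    let n := input.1 in let adj := input.2.1 in let U := input.2.2.1 in
    let T := input.2.2.2.1 in let k := input.2.2.2.2 in
    let pow2 j := CCall shift_fn (CNum 1, j) in
    let! vs := CCall iota_fn (CNum 0, n) in
    let! k4 := k + k + (k + k) in
    let! colors := CCall iota_fn (CNum 0, pow2 (k4 + CNum 3)) in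
    let! l := CCall up_log_fn (CNum 1, n) in
    let! H := CCall hash_family_fn
      (colors, vs, CCall mul_fn (l + l + CNum 1, pow2 (k4 + CNum 2))) in
    let! A := CCall split_network_fn ((adj, (U, (n, k + CNum 1))), vs) in
    let! L := CCall separator_lists_fn ((A, (T, k)), n, vs) in
    let! ts := CCall tuples_fn (colors, k) in
    [::] :: CCall family_fn (L, ts, H)).

Local Close Scope code_scope.

Definition prog : program :=
  [:: main_body; iota_body; shift_body; mul_body; up_log_body; ncons_body nat;
      mem_body; assoc_body nat; round_body; init_table_body; bfs_body;
      source_path_body; rem_body; augment_body; flow_body; crossing_arc_body;
      delete_tails_body; cat_body nat; separator_tree_body;
      separator_lists_body; drop_body nat; exit_arcs_body; split_network_body;
      color_body; weight_body; cost_body; cheapest_body; new_hash_body;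
      hash_family_body; cons_all_body; extend_tuples_body; tuples_body;
      colored_in_body; has_colored_body; shadow_list_body; shadows_body;
      family_body; row_body].

(** * Correctness and cost of the program *)

Lemma up_logS p n : 1 < p ->
  up_log p n.+1 = up_log p n + (p ^ up_log p n < n.+1).
Proof.
move=> p1; apply/eqP; rewrite eqn_leq; case: ltnP => le.
  rewrite addn1 up_log_min //=; last first.
    by rewrite expnS; apply: leq_ltn_trans (up_logP n p1) _;
      rewrite ltn_Pmull // expn_gt0 ltnW.
  rewrite ltnNge; apply: contraL le => le'; rewrite -leqNgt.
  by apply: leq_trans (up_logP n.+1 p1) _; rewrite leq_exp2l.
by rewrite addn0 up_log_min //= leq_up_log.
Qed.

Lemma up_log_le p n : 1 < p -> up_log p n <= n.
Proof. by move=> p1; apply: up_log_min => //; apply/ltnW/ltn_expl. Qed.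

Lemma encode_vals n (A : {set 'I_n}) : encode (vals A) = enc_set A.
Proof. by rewrite /encode /= /vals -map_comp. Qed.

Lemma encode_map_vals n (Z : seq {set 'I_n}) :
  encode [seq vals A | A <- Z] = enc_output Z.
Proof.
rewrite /enc_output; congr enc_seq; rewrite -map_comp; apply: eq_map => A.
exact: encode_vals.
Qed.

Definition main_input (G : digraph) (T : {set vertex G}) (k : nat) :=
  (nb_vertices G, (adjacency G, (vals (undeletable G), (vals T, k)))).

Lemma encode_main_input (G : digraph) (T : {set vertex G}) k :
  encode (main_input T k) = enc_input T k.
Proof.
rewrite /enc_input -!encode_vals; congr (VPair _ (VPair (enc_seq _) _)).
by rewrite -map_comp; apply: eq_map => u; apply: encode_vals.
Qed.

Definition budget m d := (100 * m) ^ d.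

Section Verification.
Variable m : nat.
Hypothesis m_gt0 : 0 < m.
Implicit Types (A p : arcs nat) (B : table nat) (Ts Src D vs colors : seq nat).
Implicit Types (h : hash) (H : seq hash) (t : seq nat) (ts : seq (seq nat)).

Lemma budget_gt0 d : 0 < budget m d.
Proof. by rewrite expn_gt0 muln_gt0 m_gt0. Qed.

Lemma budget_le d d' : d <= d' -> budget m d <= budget m d'.
Proof. by apply: leq_pexp2l; rewrite muln_gt0 m_gt0. Qed.

Lemma budgetS d : budget m d.+1 = 100 * m * budget m d.
Proof. exact: expnS. Qed.

Lemma budget_lt d d' : d < d' -> 100 * budget m d <= budget m d'.
Proof.
by move/budget_le; apply: leq_trans; rewrite budgetS leq_mul // leq_pmulr.
Qed.

Lemma call_list (A B C : encType) (f : func (C * seq A) B) base step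
    (F : seq A -> B) (ctx : C) s d :
  nth (EConst 0) prog (fn_index f) = listrec f base step -> size s <= m ->
  ev prog [:: encode ([::] : seq A); encode ctx; encode (ctx, [::] : seq A)]
    (base (CVar 1)) (F [::]) (10 * budget m d) ->
  (forall (x : A) (t : seq A), suffix (x :: t) s ->
     ev prog [:: encode (F t); encode t; encode x; encode (x :: t); encode ctx;
                 encode (ctx, x :: t)]
       (step (CVar 1) (CVar 3) (CVar 4) (CVar 5)) (F (x :: t))
       (50 * budget m d)) ->
  call prog f (ctx, s) (F s) (budget m d.+1).
Proof.
move=> Pf le; rewrite budgetS.
exact: call_listrec Pf le m_gt0 (budget_gt0 d).
Qed.

Lemma call_iter (B C : encType) (f : func (C * nat) B) base step
    (F : nat -> B) ctx n d :
  nth (EConst 0) prog (fn_index f) = natrec f base step -> n <= m ->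
  ev prog [:: encode 0; encode ctx; encode (ctx, 0)] (base (CVar 1)) (F 0)
    (10 * budget m d) ->
  (forall j, j < n ->
     ev prog [:: encode (F j); encode j; encode j.+1; encode ctx;
                 encode (ctx, j.+1)]
       (step (CVar 1) (CVar 3) (CVar 4)) (F j.+1) (50 * budget m d)) ->
  call prog f (ctx, n) (F n) (budget m d.+1).
Proof.
move=> Pf le; rewrite budgetS.
exact: call_natrec Pf le m_gt0 (budget_gt0 d).
Qed.

(* Linear arithmetic suffices once each smaller budget is known only as a number
   at most 1/100 of the largest one. *)
Ltac pay :=
  rewrite /=;
  lazymatch goal with
  | |- is_true (_ <= ?rhs) =>
    lazymatch rhs with
    | context [budget m ?d] =>
      move: (budget_gt0 d) (budget_gt0 0);
      repeat match goal with
      | |- context [budget m ?i] =>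
        lazymatch i with
        | d => fail
        | _ => move: (@budget_lt i d isT); move: (budget m i) => ?
        end
      end;
      move: (budget m d) => ?; clear; lia
    end
  end.

Ltac run := by apply: ev_conv; [evs | | pay].

Lemma call_iota s j : j <= m ->
  call prog iota_fn (s, j) (iota s j) (budget m 1).
Proof.
move=> le; apply: (call_weaken (c := j * 50 + 20)); last first.
  by rewrite /budget; nia.
elim: j s {le} => [|j IH] s;
  (eapply call_fun; first exact: (erefl iota_body)); apply: ev_weaken.
- by eapply (ev_if_cond (c1 := 0)); [evs | | move=> _; evs].
- by [].
- eapply (ev_if_cond (c2 := 0)); [evs | move=> _ | by []].
  eapply ev_conv; first evs.
  + by rewrite /= subn1; exact: IH.
  + by rewrite /= addn1.
  + exact: leqnn.
- by rewrite /=; lia.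
Qed.

Lemma call_shift x j : j <= m ->
  call prog shift_fn (x, j) (x * 2 ^ j) (budget m 1).
Proof.
move=> le; apply: (call_iter (f := shift_fn)
  (F := fun j => x * 2 ^ j) (erefl shift_body) le).
  by apply: ev_conv; [evs | rewrite muln1 | pay].
by move=> i _; apply: ev_conv; [evs | rewrite expnS; lia | pay].
Qed.

Lemma call_mul x j : j <= m -> call prog mul_fn (x, j) (j * x) (budget m 1).
Proof.
move=> le; apply: (call_iter (f := mul_fn)
  (F := fun j => j * x) (erefl mul_body) le).
  run.
by move=> i _; run.
Qed.

Lemma call_up_log n : n <= m ->
  call prog up_log_fn (1, n) (up_log 2 n) (budget m 2).
Proof.
move=> le; apply: (call_iter (f := up_log_fn)
  (F := up_log 2) (erefl up_log_body) le).
  run.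
move=> j lt; apply: ev_conv; first evs.
- exact: call_shift (leq_trans (@up_log_le 2 j isT) (ltnW (leq_trans lt le))).
- by rewrite up_logS //= mul1n addn1; case: ifP; rewrite ?addn0.
- pay.
Qed.

Lemma call_ncons (A : encType) (x : A) s j : j <= m ->
  call prog ncons_fn (x, s, j) (ncons j x s) (budget m 1).
Proof.
move=> le; apply: (call_iter (f := ncons_fn)
  (F := fun j => ncons j x s) (erefl (ncons_body A)) le).
  run.
by move=> i _; run.
Qed.

Lemma call_mem x s : size s <= m ->
  call prog mem_fn (x, s) (x \in s) (budget m 1).
Proof.
move=> le.
apply: (call_list (f := mem_fn)
  (F := fun s : seq nat => x \in s) (erefl mem_body) le).
  run.
by move=> y t _; apply: ev_conv; [evs | rewrite inE; case: eqP | pay].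
Qed.

Lemma call_assoc (A : encType) x (B : seq (nat * A)) : size B <= m ->
  call prog assoc_fn (x, B) (assoc x B) (budget m 1).
Proof.
move=> le; apply: (call_list (f := assoc_fn)
  (F := assoc x) (erefl (assoc_body A)) le).
  run.
by move=> e t _; run.
Qed.

Lemma call_round A (B : table nat) : size B + size A <= m ->
  call prog round_fn (B, A) (round A B) (budget m 2).
Proof.
move=> le; have leA : size A <= m by apply: leq_trans le; apply: leq_addl.
apply: (call_list (f := round_fn)
  (F := fun A => round A B) (erefl round_body) leA) => [|a t suf].
  run.
have leR : size (round t B) <= m.
  have := size_suffix suf; have := size_round t B.
  by move: le; rewrite /=; clear; lia.
rewrite /= /relax -isSome_assoc; apply: ev_weaken.
  eapply ev_if_some; first by evs; exact: call_assoc.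
    by move=> p ->; evs.
  move=> ->; eapply ev_if_some; first by evs; exact: call_assoc.
    by move=> p ->; evs.
  by move=> ->; evs.
pay.
Qed.

Lemma call_init_table Ts : size Ts <= m ->
  call prog init_table_fn (0, Ts) (init_table Ts) (budget m 1).
Proof.
move=> le; apply: (call_list (f := init_table_fn)
  (F := @init_table nat) (erefl init_table_body) le).
  run.
by move=> x s _; run.
Qed.

Lemma call_bfs Ts A : size Ts + size A * size A + size A <= m ->
  call prog bfs_fn (Ts, A, A) (bfs Ts A) (budget m 3).
Proof.
move=> le; have leA : size A <= m by apply: leq_trans le; apply: leq_addl.
apply: (call_list (f := bfs_fn) (erefl bfs_body) leA
  (F := fun s : arcs nat => iter (size s) (round A) (init_table Ts)))
    => [|a t suf].
  apply: ev_conv; first evs; [apply: call_init_table | by [] | pay].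
  by move: le; rewrite /=; clear; lia.
apply: ev_conv; first evs; [apply: call_round | by [] | pay].
apply: leq_trans (leq_add (size_rounds Ts (size t) A) (leqnn _))
  (leq_trans _ le).
by rewrite leq_add2r leq_add2l leq_mul2r (ltnW (size_suffix suf)) orbT.
Qed.

Lemma call_source_path (B : table nat) Src : size Src <= m -> size B <= m ->
  call prog source_path_fn (B, Src) (source_path Src B) (budget m 2).
Proof.
move=> leS leB; apply: (call_list (f := source_path_fn)
  (F := fun Src => source_path Src B) (erefl source_path_body) leS) => [|x t _].
  run.
rewrite /source_path /=; apply: ev_weaken.
  eapply ev_if_some; first by evs; exact: call_assoc.
    by move=> p ->; evs.
  by move=> ->; evs.
pay.
Qed.

Lemma call_rem (a : nat * nat) A : size A <= m ->
  call prog rem_fn (a, A) (rem a A) (budget m 2).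
Proof.
move=> le; apply: (call_list (f := rem_fn)
  (F := rem a) (erefl rem_body) le) => [|b t _].
  run.
by apply: ev_conv; [evs | rewrite /= -pair_eqE | pay].
Qed.

Lemma call_augment A p : size A + size p <= m ->
  call prog augment_fn (A, p) (augment A p) (budget m 3).
Proof.
move=> le; have lep : size p <= m by apply: leq_trans le; apply: leq_addl.
apply: (call_list (f := augment_fn)
  (F := augment A) (erefl augment_body) lep) => [|a t suf].
  run.
apply: ev_conv; first evs; [apply: call_rem | by [] | pay].
have size_le s : size (augment A s) <= size A + size s.
  elim: s => [|b s IH] /=; first by rewrite addn0.
  by rewrite addnS ltnS; apply: leq_trans IH; apply/size_subseq/rem_subseq.
apply: leq_trans (size_le t) (leq_trans _ le).
by rewrite leq_add2l (ltnW (size_suffix suf)).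
Qed.

Lemma call_flow_step Ts Src A j c :
  size Src <= m -> size Ts + size A * size A + size A <= m ->
  (forall p i, j = i.+1 -> source_path Src (bfs Ts A) = Some p ->
     call prog flow_fn (Ts, Src, (augment A p, i))
       (flow Ts i (augment A p) Src) c) ->
  call prog flow_fn (Ts, Src, (A, j)) (flow Ts j A Src) (c + 50 * budget m 3).
Proof.
move=> leS leA rec; rewrite flowE; have size_bfs : size (bfs Ts A) <= m.
  exact: leq_trans (size_rounds Ts (size A) A) (leq_trans (leq_addr _ _) leA).
eapply call_fun; first exact: (erefl flow_body).
apply: ev_weaken.
  eapply ev_let; first by evs; apply: call_bfs.
  eapply ev_if_some; first by evs; apply: call_source_path.
    move=> p /= path_eq; rewrite path_eq.
    eapply (ev_if_cond (c1 := c + budget m 3 + 50) (c2 := 1)); first by evs.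
      case: j rec => // j rec _; apply: ev_conv; first evs.
      - apply: call_augment; have [_ _ [_ _ _ le]] := source_path_bfs path_eq.
        rewrite /= addnC; apply: leq_trans leA; rewrite leq_add2r.
        exact: leq_trans le (size_rounds Ts (size A) A).
      - by rewrite /= subn1; apply: rec.
      - by [].
      - by rewrite /=; lia.
    by case: j rec => // rec _; evs.
  by move=> ->; evs.
pay.
Qed.

Lemma call_flow Ts Src A j : size Src <= m -> j < m ->
  size Ts + size A * size A + size A <= m ->
  call prog flow_fn (Ts, Src, (A, j)) (flow Ts j A Src) (budget m 4).
Proof.
move=> leS lej leA.
have : call prog flow_fn (Ts, Src, (A, j)) (flow Ts j A Src)
  (j.+1 * (50 * budget m 3)).
  elim: j A leA {lej} => [|j IH] A leA;
    rewrite mulSnr; apply: call_flow_step => // p i.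
  case=> <- /source_path_bfs[x _ [_ sub up _]].
  by apply: IH; rewrite size_augment.
move/call_weaken; apply; rewrite budgetS mulnA leq_mul2r; apply/orP; right.
by move: lej; clear; lia.
Qed.

Lemma call_crossing_arc A B : size A <= m -> size B <= m ->
  call prog crossing_arc_fn (B, A) (crossing_arc A B) (budget m 2).
Proof.
move=> leA leB; apply: (call_list (f := crossing_arc_fn)
  (F := fun A => crossing_arc A B) (erefl crossing_arc_body) leA) => [|a t _].
  run.
rewrite /crossing_arc /= /unreached /= negbK -!isSome_assoc; apply: ev_weaken.
  eapply ev_if_some; first by evs; exact: call_assoc.
    by move=> p ->; evs.
  move=> ->; eapply ev_if_some; first by evs; exact: call_assoc.
    by move=> p ->; evs.
  by move=> ->; evs.
pay.
Qed.

Lemma call_delete_tails A D : size A <= m -> size D <= m ->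
  call prog delete_tails_fn (D, A) (delete_tails A D) (budget m 2).
Proof.
move=> leA leD; apply: (call_list (f := delete_tails_fn)
  (F := fun A => delete_tails A D) (erefl delete_tails_body) leA) => [|a t _].
  run.
apply: ev_conv; first evs; [exact: call_mem | by rewrite /=; case: ifP | pay].
Qed.

Lemma call_cat (E : encType) (s1 s2 : seq E) : size s1 <= m ->
  call prog cat_fn (s2, s1) (s1 ++ s2) (budget m 1).
Proof.
move=> le; apply: (call_list (f := cat_fn)
  (F := fun s => s ++ s2) (erefl (cat_body E)) le).
  run.
by move=> x s _; run.
Qed.

Section SeparatorTree.
Variables (A : arcs nat) (Ts : seq nat) (k : nat).
Hypothesis k_lt : k < m.
Hypothesis network_le : size Ts + size A * size A + size A <= m.
Let tree := separator_tree A Ts k.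

Lemma call_separator_tree_step j D Src c :
  size Src <= m -> size D <= m -> 2 ^ j <= m ->
  (forall i D' Src', j = i.+1 ->
     size D' <= (size D).+1 -> size Src' <= (size Src).+1 ->
     call prog separator_tree_fn (A, (Ts, k), (i, (D', Src')))
       (tree i D' Src') c) ->
  call prog separator_tree_fn (A, (Ts, k), (j, (D, Src))) (tree j D Src)
    (2 * c + 50 * budget m 4).
Proof.
move=> leS leD le2 rec.
eapply call_fun; first exact: (erefl separator_tree_body).
pose A' := delete_tails A D.
have leA' : size A' <= size A by rewrite size_filter count_size.
have leA : size A <= m by apply: leq_trans network_le; apply: leq_addl.
have le_network : size Ts + size A' * size A' + size A' <= m.
  by apply: leq_trans network_le; rewrite !leq_add ?leq_mul.
case: j le2 rec => [|j] le2 rec; apply: ev_weaken.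
- by eapply (ev_if_cond (c1 := 0)); [evs | | move=> _; evs].
- pay.
- eapply (ev_if_cond (c2 := 0)); [evs | move=> _ | by []].
  eapply ev_let; first by evs; exact: call_delete_tails.
  rewrite /tree /= -/A'.
  eapply ev_if_some; first by evs; apply: call_flow.
    move=> B /= flow_eq; rewrite flow_eq.
    have leB : size B <= m.
      apply: leq_trans (size_flow flow_eq) _.
      exact: leq_trans (leq_addr _ _) le_network.
    eapply ev_if_some.
    - by evs; exact: call_crossing_arc (leq_trans leA' leA) leB.
    - move=> a /= cross_eq; rewrite cross_eq; evs.
      - by rewrite /= subn1; apply: rec.
      - by rewrite /= subn1; apply: rec.
      - apply: call_cat; apply: leq_trans (size_separator_tree _ _ _ _ _ _)
          (leq_trans _ le2).
        by rewrite leq_exp2l.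
    - by move=> /= ->; eapply ev_conv; [evs | | exact: leqnn].
  by move=> /= ->; evs.
- pay.
Qed.

Lemma call_separator_tree j D Src :
  size Src + j <= m -> size D + j <= m -> 2 ^ j <= m ->
  call prog separator_tree_fn (A, (Ts, k), (j, (D, Src))) (tree j D Src)
    (budget m 5).
Proof.
move=> leS leD le2; set c := 50 * budget m 4.
have : call prog separator_tree_fn (A, (Ts, k), (j, (D, Src))) (tree j D Src)
    (2 ^ j.+1 * c - c).
  elim: j D Src leS leD le2 => [|j IH] D Src leS leD le2.
    apply: call_weaken (call_separator_tree_step (c := 0) _ _ _ _) _ => //.
      by move: leS; clear; lia.
      by move: leD; clear; lia.
    by rewrite -/c; clear; lia.
  apply: call_weaken.
    apply: (call_separator_tree_step (c := 2 ^ j.+1 * c - c) _ _ le2).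
    - by move: leS; clear; lia.
    - by move: leD; clear; lia.
    move=> i D' Src' [<-] leD' leS'; apply: IH.
    - by move: leS leS'; clear; lia.
    - by move: leD leD'; clear; lia.
    - by apply: leq_trans le2; rewrite leq_exp2l.
  have : c <= 2 ^ j.+1 * c by rewrite leq_pmull // expn_gt0.
  by rewrite -/c [2 ^ j.+2]expnS; clear; lia.
move/call_weaken; apply; apply: leq_trans (leq_subr _ _) _.
by rewrite budgetS /c expnS mulnACA -[leqRHS]mulnA leq_mul2l leq_mul2r le2 orbT.
Qed.

End SeparatorTree.

Lemma call_separator_lists (G : digraph) (T : {set vertex G}) k :
  let n := nb_vertices G in let A := network G k in
  n <= m -> n + size A * size A + size A <= m ->
  2 * k + 3 <= m -> 2 ^ (2 * k).+1 <= m ->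
  call prog separator_lists_fn (A, (vals T, k), n, iota 0 n)
    (separator_lists T k) (budget m 6).
Proof.
move=> n A len leA lek le2.
have leT : size (vals T) <= m by apply: leq_trans (size_vals_le T) len.
apply: (call_list (f := separator_lists_fn) (erefl separator_lists_body)
  (F := fun s => [seq (x, separator_list T k x) | x <- s & x \notin vals T]))
    => [||x s _].
- by rewrite size_iota.
- run.
apply: ev_conv; first evs.
- exact: call_mem leT.
- rewrite /= addnn -mul2n addn1.
  apply: call_separator_tree => //=; try by move: lek; clear; lia.
  by apply: leq_trans leA; rewrite !leq_add2r size_vals_le.
- by rewrite /=; case: ifP.
- pay.
Qed.

Lemma call_drop (E : encType) (s : seq E) j : j <= m ->
  call prog drop_fn (s, j) (drop j s) (budget m 1).
Proof.
move=> le; apply: (call_iter (f := drop_fn)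
  (F := fun j => drop j s) (erefl (drop_body E)) le).
  by apply: ev_conv; [evs | rewrite drop0 | pay].
move=> i _; rewrite -[i.+1]add1n -drop_drop; apply: ev_weaken.
  eapply ev_if_cons; first evs.
    by move=> x t ->; rewrite /= drop0; evs.
  by move=> ->; evs.
pay.
Qed.

Lemma call_row (adj : seq (seq nat)) u : u <= m ->
  call prog row_fn (adj, u) (nth [::] adj u) (budget m 2).
Proof.
move=> le; eapply call_fun; first exact: (erefl row_body).
rewrite -[u in nth _ _ u]addn0 -nth_drop; apply: ev_weaken.
  eapply ev_if_cons; first by evs; apply: call_drop.
    by move=> row rows /= ->; evs.
  by move=> /= ->; evs.
pay.
Qed.

Lemma call_exit_arcs x copies A row : copies <= m -> size row <= m ->
  call prog exit_arcs_fn (x, copies, A, row)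
    (flatten [seq nseq copies (x, w) | w <- row] ++ A) (budget m 2).
Proof.
move=> lec ler; apply: (call_list (f := exit_arcs_fn) (erefl exit_arcs_body) ler
  (F := fun row : seq nat => flatten [seq nseq copies (x, w) | w <- row] ++ A))
    => [|w s _].
  run.
apply: ev_conv; first evs; [exact: call_ncons | | pay].
by rewrite /= -catA cat_nseq.
Qed.

Lemma call_split_network n (adj : seq (seq nat)) (U : seq nat) k :
  n <= m -> k < m -> size U <= m -> {in adj, forall row, size row <= m} ->
  call prog split_network_fn ((adj, (U, (n, k.+1))), iota 0 n)
    (split_network n adj U k) (budget m 3).
Proof.
move=> len lek leU leadj; pose arcs_of u :=
  nseq (if u \in U then k.+1 else 1) (u, n + u) ++
  flatten [seq nseq k.+1 (n + u, w) | w <- nth [::] adj u].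
apply: (call_list (f := split_network_fn) (erefl split_network_body)
  (F := fun s : seq nat => flatten [seq arcs_of u | u <- s])) => [||u s suf].
- by rewrite size_iota.
- run.
have ltu : u < n.
  by have := mem_infix (suffixW suf) (mem_head u s); rewrite mem_iota.
have le_row : size (nth [::] adj u) <= m.
  case: (ltnP u (size adj)) => [/(mem_nth [::])/leadj //|ge].
  by rewrite nth_default.
apply: ev_conv; first evs.
- exact: call_row (leq_trans (ltnW ltu) len).
- exact: call_exit_arcs lek le_row.
- exact: call_mem leU.
- by apply: call_ncons; case: ifP.
- by rewrite /= -cat_nseq catA.
- pay.
Qed.

Lemma call_color x h : size h <= m ->
  call prog color_fn (x, h) (color h x) (budget m 2).
Proof.
move=> le; eapply call_fun; first exact: (erefl color_body).
rewrite /color; apply: ev_weaken.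
  eapply ev_if_some; first by evs; exact: call_assoc.
    by move=> c /= ->; evs.
  by move=> /= ->; evs.
pay.
Qed.

Lemma call_weight x y H : size H <= m -> {in H, forall h, size h <= m} ->
  call prog weight_fn (x, y, H) (weight H x y) (budget m 3).
Proof.
move=> leH leh; apply: (call_list (f := weight_fn) (F := fun H => weight H x y)
  (erefl weight_body) leH) => [|h H' suf].
  run.
have leh' : size h <= m by apply/leh/(mem_infix (suffixW suf))/mem_head.
apply: ev_conv; first evs; [exact: call_color | exact: call_color | | pay].
by rewrite /weight /=; case: eqP => _ //; rewrite expnS mul2n -addnn.
Qed.

Lemma call_cost x c H h : size H <= m -> {in H, forall h, size h <= m} ->
  size h <= m ->
  call prog cost_fn ((x, (c, H)), h) (cost H h x c) (budget m 4).
Proof.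
move=> leH lehs leh; apply: (call_list (f := cost_fn)
  (F := fun h => cost H h x c) (erefl cost_body) leh) => [|e h' _].
  by apply: ev_conv; [evs | rewrite /cost big_nil | pay].
apply: ev_conv; first evs; [exact: call_weight | | pay].
by rewrite /cost big_cons.
Qed.

Lemma call_cheapest colors x H h :
  size H <= m -> {in H, forall h, size h <= m} ->
  size h <= m -> size colors <= m ->
  call prog cheapest_fn ((x, (h, H)), colors) (cheapest colors H h x)
    (budget m 5).
Proof.
move=> leH lehs leh lec; apply: (call_list (f := cheapest_fn)
  (F := fun colors => cheapest colors H h x)
  (erefl cheapest_body) lec) => [|c s _].
  run.
by apply: ev_conv; first evs; [exact: call_cost | exact: call_cost | | pay].
Qed.

Lemma call_new_hash colors vs H :
  size H <= m -> {in H, forall h, size h <= m} ->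
  size vs <= m -> size colors <= m ->
  call prog new_hash_fn (colors, H, vs) (new_hash colors vs H) (budget m 6).
Proof.
move=> leH lehs lev lec; apply: (call_list (f := new_hash_fn)
  (F := fun vs => new_hash colors vs H)
  (erefl new_hash_body) lev) => [|x s suf].
  run.
apply: ev_conv; first evs; [apply: call_cheapest | by [] | pay] => //.
rewrite -(size_map fst) -/(unzip1 _) unzip1_new_hash.
exact: leq_trans (ltnW (size_suffix suf)) lev.
Qed.

Lemma call_hash_family colors vs L :
  L <= m -> size vs <= m -> size colors <= m ->
  call prog hash_family_fn (colors, vs, L) (hash_family colors vs L)
    (budget m 7).
Proof.
move=> leL lev lec; apply: (call_iter (f := hash_family_fn)
  (F := hash_family colors vs) (erefl hash_family_body) leL) => [|j lt].
  run.
apply: ev_conv; first evs; [apply: call_new_hash | by [] | pay] => //.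
  by rewrite size_hash_family; apply: leq_trans (ltnW lt) leL.
by move=> h /mem_hash_family[H ->]; rewrite size_new_hash.
Qed.

Lemma call_colored_in h t D : size h <= m -> size t <= m -> size D <= m ->
  call prog colored_in_fn (h, t, D) (colored_in h t D) (budget m 3).
Proof.
move=> leh le_t leD; apply: (call_list (f := colored_in_fn)
  (F := colored_in h t) (erefl colored_in_body) leD) => [|x s _].
  run.
apply: ev_conv; first evs; [exact: call_color | exact: call_mem | | pay].
by rewrite /=; case: ifP.
Qed.

Lemma call_has_colored h t L : size h <= m -> size t <= m -> size L <= m ->
  {in L, forall D, size D <= m} ->
  call prog has_colored_fn (h, t, L) (has (colored_in h t) L) (budget m 4).
Proof.
move=> leh le_t leL leD; apply: (call_list (f := has_colored_fn)
  (F := has (colored_in h t)) (erefl has_colored_body) leL) => [|D s suf].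
  run.
apply: ev_conv; first evs.
- apply: (call_colored_in (D := D)) => //.
  by apply/leD/(mem_infix (suffixW suf))/mem_head.
- by rewrite /=; case: ifP.
- pay.
Qed.

Definition all_small (L : seq (nat * seq (seq nat))) :=
  size L <= m /\
  {in L, forall e, size e.2 <= m /\ {in e.2, forall D, size D <= m}}.

Lemma call_shadow_list h t L : size h <= m -> size t <= m -> all_small L ->
  call prog shadow_list_fn (h, t, L) (shadow_list L h t) (budget m 5).
Proof.
move=> leh le_t [leL leD]; apply: (call_list (f := shadow_list_fn)
  (F := fun L => shadow_list L h t) (erefl shadow_list_body) leL) => [|e s suf].
  run.
have [le1 le2] := leD e (mem_infix (suffixW suf) (mem_head e s)).
apply: ev_conv; first evs; [exact: call_has_colored | | pay].
by rewrite /shadow_list /=; case: ifP.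
Qed.

Lemma all_small_separator_lists (G : digraph) (T : {set vertex G}) k :
  nb_vertices G <= m -> 2 * k + 1 <= m -> 2 ^ (2 * k + 1) <= m ->
  all_small (separator_lists T k).
Proof.
move=> len lek le2; split=> [|_ /mapP[x _ ->]].
  rewrite size_map size_filter; apply: leq_trans (count_size _ _) _.
  by rewrite size_iota.
split; first exact: leq_trans (size_separator_list _ _ _) le2.
by move=> D /size_mem_separator_tree /leq_trans; apply; rewrite add0n -addn1.
Qed.

Lemma call_cons_all t acc colors : size colors <= m ->
  call prog cons_all_fn (t, acc, colors) ([seq c :: t | c <- colors] ++ acc)
    (budget m 1).
Proof.
move=> le; apply: (call_list (f := cons_all_fn) (erefl cons_all_body) le
  (F := fun colors => [seq c :: t | c <- colors] ++ acc)).
  run.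
by move=> c s _; run.
Qed.

(* The number of colour tuples is not polynomial: the loops over them cost [q]
   times a power of [m]. *)
Section LongLoops.
Variable q : nat.
Hypothesis q_gt0 : 0 < q.

Lemma long_budget_lt d d' : d < d' -> 100 * (q * budget m d) <= q * budget m d'.
Proof. by move=> /budget_lt; rewrite mulnCA leq_mul2l orbC => ->. Qed.

Lemma budget_lt_long d d' : d < d' -> 100 * budget m d <= q * budget m d'.
Proof. by move=> /budget_lt /leq_trans; apply; rewrite leq_pmull. Qed.

Ltac pay_long d :=
  rewrite /=; move: (@budget_lt 0 1 isT) (budget_gt0 0);
  repeat match goal with
  | |- context [q * budget m ?i] =>
    lazymatch i with
    | d => fail
    | _ => move: (@long_budget_lt i d isT); move: (q * budget m i) => ?
    end
  end;
  repeat match goal with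
  | |- context [budget m ?i] =>
    lazymatch i with
    | d => fail
    | _ => move: (@budget_lt_long i d isT); move: (budget m i) => ?
    end
  end;
  move: (q * budget m d) => ?; clear; lia.

Lemma call_long_list (A B C : encType) (f : func (C * seq A) B) base step
    (F : seq A -> B) (ctx : C) s d :
  nth (EConst 0) prog (fn_index f) = listrec f base step -> size s <= q ->
  ev prog [:: encode ([::] : seq A); encode ctx; encode (ctx, [::] : seq A)]
    (base (CVar 1)) (F [::]) (10 * budget m d) ->
  (forall (x : A) (t : seq A), suffix (x :: t) s ->
     ev prog [:: encode (F t); encode t; encode x; encode (x :: t); encode ctx;
                 encode (ctx, x :: t)]
       (step (CVar 1) (CVar 3) (CVar 4) (CVar 5)) (F (x :: t))
       (50 * budget m d)) ->
  call prog f (ctx, s) (F s) (q * budget m d.+1).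
Proof.
move=> Pf le Hbase Hstep.
apply: call_weaken (call_listrec Pf le q_gt0 (budget_gt0 d) Hbase Hstep) _.
by rewrite -mulnA mulnCA leq_mul2l budget_lt // orbT.
Qed.

Lemma call_extend_tuples colors ts : size colors <= m -> size ts <= q ->
  call prog extend_tuples_fn (colors, ts) (extend_tuples colors ts)
    (q * budget m 2).
Proof.
move=> lec le_t; apply: (call_long_list (f := extend_tuples_fn)
  (F := extend_tuples colors) (erefl extend_tuples_body) le_t) => [|t s _].
  run.
by apply: ev_conv; first evs; [exact: call_cons_all | | pay].
Qed.

Lemma call_tuples colors k : 0 < size colors <= m -> k <= m ->
  size colors ^ k <= q ->
  call prog tuples_fn (colors, k) (tuples colors k) (q * budget m 3).
Proof.
case/andP => colors_gt0 lec lek leq; rewrite budgetS mulnCA.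
apply: (call_natrec (P := prog) (f := tuples_fn)
  (F := tuples colors) (erefl tuples_body) lek m_gt0).
- by rewrite muln_gt0 q_gt0 budget_gt0.
- by apply: ev_conv; [evs | | pay_long 2].
move=> j lt; apply: ev_conv; first evs.
- apply: call_extend_tuples => //.
  by rewrite size_tuples; apply: leq_trans leq; rewrite leq_pexp2l // ltnW.
- by [].
- pay_long 2.
Qed.

Lemma call_shadows L h acc ts : size h <= m -> {in ts, forall t, size t <= m} ->
  all_small L -> size ts <= q ->
  call prog shadows_fn (L, h, acc, ts)
    ([seq shadow_list L h t | t <- ts] ++ acc) (q * budget m 6).
Proof.
move=> leh le_t smallL leq; apply: (call_long_list (f := shadows_fn)
  (erefl shadows_body) leq
  (F := fun ts => [seq shadow_list L h t | t <- ts] ++ acc)) => [|t s suf].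
  run.
have le_t1 := le_t t (mem_infix (suffixW suf) (mem_head t s)).
by apply: ev_conv; first evs; [exact: call_shadow_list | | pay].
Qed.

Lemma call_family L ts H : size H <= m -> {in H, forall h, size h <= m} ->
  {in ts, forall t, size t <= m} -> all_small L -> size ts <= q ->
  call prog family_fn (L, ts, H) [seq shadow_list L h t | h <- H, t <- ts]
    (q * budget m 7).
Proof.
move=> leH leh le_t smallL leq; rewrite budgetS mulnCA.
apply: (call_listrec (P := prog) (f := family_fn) (erefl family_body) leH m_gt0
  (F := fun H => [seq shadow_list L h t | h <- H, t <- ts])) => [||h s suf].
- by rewrite muln_gt0 q_gt0 budget_gt0.
- by apply: ev_conv; [evs | | pay_long 6].
have leh1 := leh h (mem_infix (suffixW suf) (mem_head h s)).
by apply: ev_conv; first evs; [exact: call_shadows | | pay_long 6].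
Qed.

Section Main.
Variables (G : digraph) (T : {set vertex G}) (k : nat).
Notation n := (nb_vertices G).
Let A := network G k.
Hypothesis n_le : n <= m.
Hypothesis palette_le : 2 ^ (4 * k + 3) <= m.
Hypothesis network_le : n + size A * size A + size A <= m.
Hypothesis hashes_le : 2 ^ (4 * k + 2) * (2 * up_log 2 n + 1) <= m.
Hypothesis tuples_le : (2 ^ (4 * k + 3)) ^ k <= q.

Lemma le_palette_pow2 j : j <= 4 * k + 3 -> 2 ^ j <= m.
Proof. by move=> le; apply: leq_trans palette_le; rewrite leq_exp2l. Qed.

Lemma palette_exponent_lt : 4 * k + 3 < m.
Proof. by apply: leq_trans palette_le; apply: ltn_expl. Qed.

Lemma call_main : call prog main_fn (main_input T k)
  [seq vals Z | Z <- covering_family T k] (q * budget m 8).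
Proof.
have lt := palette_exponent_lt; have lek : k < m by move: lt; clear; lia.
have size_vals_m (X : {set vertex G}) : size (vals X) <= m.
  by apply: leq_trans n_le; apply: size_vals_le.
have smallL : all_small (separator_lists T k).
  apply: all_small_separator_lists n_le _ _.
    by move: lt; clear; lia.
  by apply: le_palette_pow2; clear; lia.
have k4 c : k + k + (k + k) + c = 4 * k + c by clear; lia.
rewrite covering_familyE; eapply call_fun; first exact: (erefl main_body).
apply: ev_conv; first evs; rewrite /= ?k4 ?mul1n ?addn1.
- exact: call_iota.
- exact/call_shift/ltnW.
- by rewrite mul1n; apply: call_iota palette_le.
- exact: call_up_log.
- by apply: call_shift; move: lt; clear; lia.
- rewrite mul1n addnn -mul2n -addn1.
  by apply/call_mul/le_palette_pow2; clear; lia.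
- by apply: call_hash_family; rewrite ?size_iota.
- by apply: call_split_network => // _ /mapP[u _ ->].
- apply: call_separator_lists => //; first by move: lt; clear; lia.
  by apply: le_palette_pow2; clear; lia.
- by apply: call_tuples; rewrite ?size_iota ?expn_gt0 //= ltnW.
- apply: call_family; rewrite // ?size_hash_family ?size_tuples ?size_iota //.
    by move=> h /mem_hash_family[H ->]; rewrite size_new_hash size_iota.
  by move=> t /mem_tuples ->; apply: ltnW.
- by [].
- pay_long 8.
Qed.

End Main.
End LongLoops.
End Verification.

(** * Total cost *)

Lemma vertices_le_input (G : digraph) (T : {set vertex G}) k :
  nb_vertices G <= data_size (enc_input T k).
Proof.
have size_enc_seq s : size s <= data_size (enc_seq s).
  by elim: s => //= x s; lia.
rewrite -{1}[nb_vertices G]size_enum_ord.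
rewrite -(size_map (fun u => enc_set [set v | edge u v])).
apply: leq_trans (size_enc_seq _) _.
by rewrite /enc_input; move: (enc_seq _) => rows; rewrite /=; lia.
Qed.

Section InputBudget.
Variables (G : digraph) (k N : nat).
Notation n := (nb_vertices G).
Hypothesis N_gt0 : 0 < N.
Hypothesis n_le_N : n <= N.
Let base := 2 ^ (4 * k + 5) * N.
Let s := size (network G k).

Lemma base_ge8 : 8 <= base.
Proof.
apply: leq_trans (leq_pmulr _ N_gt0); apply: (@leq_trans (2 ^ 5)) => //.
by rewrite leq_exp2l // leq_addl.
Qed.

Lemma base_leX i : 0 < i -> base <= base ^ i.
Proof.
by move=> i0; rewrite -{1}[base]expn1 leq_pexp2l // (leq_trans _ base_ge8).
Qed.

Lemma vertices_le_base : n <= base.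
Proof. by apply: leq_trans n_le_N _; rewrite leq_pmull // expn_gt0. Qed.

Lemma palette_le_base : 2 ^ (4 * k + 3) <= base.
Proof.
by apply: leq_trans (leq_pmulr _ N_gt0); rewrite leq_exp2l // leq_add2l.
Qed.

Lemma hashes_le_base : 2 ^ (4 * k + 2) * (2 * up_log 2 n + 1) <= base.
Proof.
rewrite /base -[5]/(2 + 3) addnA (expnD _ _ 3) -mulnA leq_mul2l.
apply/orP; right.
by have := up_log_le n (isT : 1 < 2); lia.
Qed.

Lemma network_le_base : n + s * s + s <= base ^ 5.
Proof.
have s_le : s <= base ^ 2.
  apply: leq_trans (size_network G k) (leq_trans (_ : _ <= k.+1 * 2 * N ^ 2) _).
    by rewrite -mulnA leq_mul2l; apply/orP; right; rewrite -mulnn; nia.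
  rewrite expnMn leq_mul2r; apply/orP; right.
  by have := ltn_expl (4 * k + 5) (isT : 1 < 2); rewrite -mulnn; nia.
have ss_le : s * s <= base ^ 4 by rewrite (expnD base 2 2) leq_mul.
have s_le4 : s <= base ^ 4.
  by apply: leq_trans s_le _; rewrite leq_pexp2l // (leq_trans _ base_ge8).
have n_le4 := leq_trans vertices_le_base (base_leX (isT : 0 < 4)).
apply: leq_trans (_ : 3 * base ^ 4 <= _); last first.
  by rewrite [leqRHS]expnS leq_mul2r (leq_trans _ base_ge8) ?orbT.
by move: (base ^ 4) ss_le s_le4 n_le4 => b; lia.
Qed.

End InputBudget.

Lemma covering_family_runs (G : digraph) (T : {set vertex G}) k :
  exists2 time, time <= 2 ^ (4 * k ^ 2 + 163 * k + 200) *
                        (100 ^ 8 * data_size (enc_input T k) ^ 40)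
    & runs prog (enc_input T k) (enc_output (covering_family T k)) time.
Proof.
set N := data_size _; have n_le : nb_vertices G <= N := vertices_le_input T k.
have N_gt0 : 0 < N by [].
pose base := 2 ^ (4 * k + 5) * N.
have base_le := base_leX k N_gt0 (isT : 0 < 5).
have m_gt0 : 0 < base ^ 5.
  by apply: leq_trans base_le; apply: leq_trans (base_ge8 k N_gt0).
have [|||||time le_time run] :=
  @call_main _ m_gt0 ((2 ^ (4 * k + 3)) ^ k) _ G T k _ _ _ _ (leqnn _).
- by rewrite !expn_gt0.
- exact: leq_trans (vertices_le_base k n_le) base_le.
- exact: leq_trans (palette_le_base k N_gt0) base_le.
- exact: network_le_base N_gt0 n_le.
- exact: leq_trans (hashes_le_base k N_gt0 n_le) base_le.
exists time; last by rewrite -encode_main_input -encode_map_vals.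
apply: leq_trans le_time _.
have -> : budget (base ^ 5) 8 = 100 ^ 8 * (2 ^ ((4 * k + 5) * 40) * N ^ 40).
  by rewrite /budget expnMn -[(base ^ 5) ^ 8]expnM expnMn -expnM.
have -> : 4 * k ^ 2 + 163 * k + 200 = (4 * k + 3) * k + (4 * k + 5) * 40.
  by rewrite -mulnn; lia.
rewrite (expnD 2 ((4 * k + 3) * k)) [2 ^ (_ * k)]expnM -[leqRHS]mulnA.
by rewrite leq_mul2l [leqLHS]mulnCA leqnn orbT.
Qed.

Lemma bigO_quadratic a b c :
  bigO (fun k => a * k ^ 2 + b * k + c) (fun k => k ^ 2).
Proof.
exists (a + b + c), 1 => k k_gt0.
have le : k <= k ^ 2 by rewrite -mulnn leq_pmulr.
rewrite !mulnDl !leq_add // ?leq_mul2l ?le ?orbT //.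
by rewrite leq_pmulr // expn_gt0 k_gt0.
Qed.

Theorem theorem7 :
  exists (P : program) (f g : nat -> nat) (c d : nat),
    bigO f (fun k => k ^ 2) /\ bigO g (fun k => k ^ 2) /\
    forall (G : digraph) (T : {set vertex G}) (k : nat),
    exists (t : nat) (Z : t.-tuple {set vertex G}) (time : nat),
      [/\ runs P (enc_input T k) (enc_output Z) time,
          time <= 2 ^ f k * (c * data_size (enc_input T k) ^ d),
          t <= 2 ^ g k * log2 (nb_vertices G),
          (forall i : 'I_t, tnth Z i \subset ~: T)
        & forall W Y : {set vertex G},
            W \subset ~: (T :|: undeletable G) ->
            thin T W ->
            #|W| <= k ->
            (forall v, v \in Y ->
               exists W' : {set vertex G},
                 W' \subset W /\ important_separator [set v] T W') ->
            exists i : 'I_t, W :&: tnth Z i = set0 /\ Y \subset tnth Z i].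
Proof.
exists prog, (fun k => 4 * k ^ 2 + 163 * k + 200),
  (fun k => 4 * k ^ 2 + 7 * k + 5).
exists (100 ^ 8), 40; split; first exact: bigO_quadratic.
split=> [|G T k]; first exact: bigO_quadratic.
have [time le_time run] := covering_family_runs T k.
exists (size (covering_family T k)), (in_tuple (covering_family T k)), time.
split=> //.
- exact: size_covering_family.
- by move=> i; apply/covering_family_sub/mem_tnth.
move=> W Y subW thinW cardW impY.
have [Z ZF coverZ] := covering_familyP subW thinW cardW impY.
have /tnthP[i Zi] : Z \in in_tuple (covering_family T k) by [].
by exists i; rewrite -Zi.
Qed.
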